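(* Suppose Assumption A holds. Let $x(t),v_1(t),\dots,v_k(t)$, $t\in[0,T]$, be the solution of the sphere-constrained high-index saddle dynamics with initial data $x_0,v_{1,0},\dots,v_{k,0}$, let $\{x_n,v_{1,n},\dots,v_{k,n}\}_{n=0}^N$ be the numerical solution of the semi-implicit scheme with step size $\tau=T/N$ and the same initial data, and define the errors $e^x_n:=x(t_n)-x_n$ and $e^{v_i}_n:=v_i(t_n)-v_{i,n}$ for $1\le n\le N$, $1\le i\le k$. Then there exist constants $\tau_0>0$ and $Q>0$, with $Q$ independent of $\tau$, $n$ and $N$, such that whenever $\tau\le\tau_0$, $$\max_{1\le n\le N}\max\{\|e^x_n\|,\|e^{v_1}_n\|,\dots,\|e^{v_k}_n\|\}\le Q\tau .$$
   Context: Norm: $\|\cdot\|$ is the standard $l^2$ norm of a vector or matrix. $S^{d-1}$ is the unit sphere of $\mathbb R^d$. Data: $E:\mathbb R^d\to\mathbb R$ is a (twice differentiable) energy function, $F(x)=-\nabla E(x)$, $J(x)=-\nabla^2E(x)$ with $J(x)=J(x)^\top$. $T>0$ and the integer $k\ge1$ are fixed. Initial data $x_0\in S^{d-1}$, $v_{1,0},\dots,v_{k,0}\in\mathbb R^d$ satisfy $v_{i,0}^\top v_{j,0}=\delta_{ij}$ and $x_0^\top v_{i,0}=0$ for $1\le i,j\le k$. Sphere-constrained high-index saddle dynamics: for $1\le i\le k$, $$\frac{dx}{dt}=\Big(I-xx^\top-2\sum_{j=1}^kv_jv_j^\top\Big)F(x),$$ $$\frac{dv_i}{dt}=\Big(I-xx^\top-v_iv_i^\top-2\sum_{j=1}^{i-1}v_jv_j^\top\Big)J(x)v_i+x\,v_i^\top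 F(x),$$ with $x(0)=x_0$, $v_i(0)=v_{i,0}$. Its solution satisfies $x(t)\in S^{d-1}$, $v_i(t)^\top x(t)=0$, $v_i(t)^\top v_j(t)=\delta_{ij}$. Assumption A: $F(x)=\mathcal Lx+\mathcal N(x)$, where $\mathcal Lx$ is a linear part and $\mathcal N(x)$ a nonlinear part, and there is a constant $L>0$ such that for all $x,x_1,x_2\in\mathbb R^d$: $\max\{\|J(x_2)-J(x_1)\|,\|\mathcal Lx_2-\mathcal Lx_1\|,\|\mathcal N(x_2)-\mathcal N(x_1)\|\}\le L\|x_2-x_1\|$ and $\max\{\|\mathcal Lx\|,\|\mathcal N(x)\|\}\le L(1+\|x\|)$. Semi-implicit scheme: let $0=t_0<t_1<\dots<t_N=T$ be the uniform partition with step $\tau=T/N$. Starting from $x_0,v_{i,0}$, for $1\le n\le N$: $$\tilde x_n=x_{n-1}+\tau\Big(I-2\sum_{j=1}^kv_{j,n-1}v_{j,n-1}^\top\Big)(\mathcal L\tilde x_n+\mathcal N(x_{n-1}))-\tau x_{n-1}x_{n-1}^\top(\mathcal Lx_{n-1}+\mathcal N(x_{n-1})),$$ $$x_n=\tilde x_n/\|\tilde x_n\|,$$ and then, sequentially for $i=1,\dots,k$, $$\tilde v_{i,n}=v_{i,n-1}+\tau\Big(I-x_nx_n^\top-2\sum_{j=1}^{i-1}v_{j,n}v_{j,n}^\top\Big)J(x_n)\tilde v_{i,n}-\tau v_{i,n-1}v_{i,n-1}^\top J(x_n)v_{i,n-1}+\tau x_n\tilde v_{i,n}^\top F(x_n),$$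 $$\hat v_{i,n}=\tilde v_{i,n}-(\tilde v_{i,n}^\top x_n)x_n,$$ $$v_{i,n}=\frac1{Y_{i,n}}\Big(\hat v_{i,n}-\sum_{j=1}^{i-1}(\hat v_{i,n}^\top v_{j,n})v_{j,n}\Big),\qquad Y_{i,n}=\Big\|\hat v_{i,n}-\sum_{j=1}^{i-1}(\hat v_{i,n}^\top v_{j,n})v_{j,n}\Big\|.$$ Thus $\|x_n\|=1$, $v_{i,n}^\top x_n=0$, $v_{i,n}^\top v_{j,n}=\delta_{ij}$. Constants may depend on the fixed data of the problem ($E$, $\mathcal L$, $\mathcal N$, $L$, $d$, $k$, $T$, initial data). *)

(* Defs.v *)
From HB Require Import structures.
From mathcomp Require Import all_boot all_order all_algebra.
From mathcomp Require Import all_classical all_reals all_analysis.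

Set Implicit Arguments.
Unset Strict Implicit.
Unset Printing Implicit Defensive.

Import Order.TTheory GRing.Theory Num.Theory.
Import numFieldNormedType.Exports.

Local Open Scope classical_set_scope.
Local Open Scope ring_scope.

(* The library norm `|v| of a matrix is the sup norm; the norms below are the
   Euclidean one and the operator norm it induces.  The library topology on
   'cV[R]_d, used for derivatives and continuity, is the usual one. *)

Definition dotv (R : realType) (d : nat) (u w : 'cV[R]_d) : R :=
  (u^T *m w) 0 0.

Definition l2norm (R : realType) (d : nat) (u : 'cV[R]_d) : R :=
  Num.sqrt (dotv u u).

Definition l2opnorm (R : realType) (d : nat) (A : 'M[R]_d) : R :=
  sup [set l2norm (A *m u) | u in [set u : 'cV[R]_d | l2norm u = 1]].

Definition basis_vec (R : realType) (d : nat) (i : 'I_d) : 'cV[R]_d :=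
  delta_mx i 0.

Definition grad (R : realType) (d : nat) (E : 'cV[R]_d -> R) (x : 'cV[R]_d) :
    'cV[R]_d :=
  \col_i 'D_(basis_vec R i) E x.

Definition hessian (R : realType) (d : nat) (E : 'cV[R]_d -> R)
    (x : 'cV[R]_d) : 'M[R]_d :=
  \matrix_(i, j) 'D_(basis_vec R i) ('D_(basis_vec R j) E) x.

Definition twice_differentiable (R : realType) (d : nat)
    (E : 'cV[R]_d -> R) : Prop :=
  forall x, differentiable E x /\ differentiable (grad E) x.

Definition force (R : realType) (d : nat) (E : 'cV[R]_d -> R)
    (x : 'cV[R]_d) : 'cV[R]_d := - grad E x.

Definition Jmat (R : realType) (d : nat) (E : 'cV[R]_d -> R)
    (x : 'cV[R]_d) : 'M[R]_d := - hessian E x.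

(* The linear part is given by its matrix A in the standard basis. *)
Definition assumptionA (R : realType) (d : nat) (E : 'cV[R]_d -> R)
    (A : 'M[R]_d) (Nf : 'cV[R]_d -> 'cV[R]_d) (L : R) : Prop :=
  [/\ forall x, force E x = A *m x + Nf x,
      forall x1 x2,
        Num.max (l2opnorm (Jmat E x2 - Jmat E x1))
          (Num.max (l2norm (A *m x2 - A *m x1)) (l2norm (Nf x2 - Nf x1)))
        <= L * l2norm (x2 - x1)
    & forall x,
        Num.max (l2norm (A *m x)) (l2norm (Nf x)) <= L * (1 + l2norm x)].

Definition admissible_data (R : realType) (d k : nat) (x0 : 'cV[R]_d)
    (v0 : 'I_k -> 'cV[R]_d) : Prop :=
  [/\ l2norm x0 = 1,
      forall i j, dotv (v0 i) (v0 j) = (i == j)%:R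
    & forall i, dotv x0 (v0 i) = 0].

Definition saddle_rhs_x (R : realType) (d k : nat) (E : 'cV[R]_d -> R)
    (x : 'cV[R]_d) (v : 'I_k -> 'cV[R]_d) : 'cV[R]_d :=
  (1%:M - x *m x^T - 2 *: \sum_(j < k) v j *m (v j)^T) *m force E x.

Definition saddle_rhs_v (R : realType) (d k : nat) (E : 'cV[R]_d -> R)
    (x : 'cV[R]_d) (v : 'I_k -> 'cV[R]_d) (i : 'I_k) : 'cV[R]_d :=
  (1%:M - x *m x^T - v i *m (v i)^T
     - 2 *: \sum_(j < k | (j < i)%N) v j *m (v j)^T) *m Jmat E x *m v i
  + dotv (v i) (force E x) *: x.

(* Classical solution on [0, T]: since the right-hand side is continuous, the
   equations at t = 0 and t = T (with one-sided derivatives) follow from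
   continuity on [0, T] and the equations on ]0, T[. *)
Definition saddle_dynamics_solution (R : realType) (d k : nat)
    (E : 'cV[R]_d -> R) (T : R) (x0 : 'cV[R]_d) (v0 : 'I_k -> 'cV[R]_d)
    (x : R -> 'cV[R]_d) (v : 'I_k -> R -> 'cV[R]_d) : Prop :=
  [/\ x 0 = x0 /\ (forall i, v i 0 = v0 i),
      {within `[0, T], continuous x} /\
        (forall i, {within `[0, T], continuous (v i)}),
      forall t : R, 0 < t < T ->
        is_derive t (1 : R) x (saddle_rhs_x E (x t) (fun j => v j t))
    & forall i (t : R), 0 < t < T ->
        is_derive t (1 : R) (v i) (saddle_rhs_v E (x t) (fun j => v j t) i)].

(* One step (xp, vp) -> (x, v) of size tau.  The equations for xt and vt i are
   implicit.  Inverses follow the convention 0^-1 = 0; nonvanishing of the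
   normalizing denominators is not required here. *)
Definition semi_implicit_step (R : realType) (d k : nat) (E : 'cV[R]_d -> R)
    (A : 'M[R]_d) (Nf : 'cV[R]_d -> 'cV[R]_d) (tau : R)
    (xp : 'cV[R]_d) (vp : 'I_k -> 'cV[R]_d)
    (x : 'cV[R]_d) (v : 'I_k -> 'cV[R]_d) : Prop :=
  exists (xt : 'cV[R]_d) (vt : 'I_k -> 'cV[R]_d),
  [/\ xt = xp
        + tau *: ((1%:M - 2 *: \sum_(j < k) vp j *m (vp j)^T)
                    *m (A *m xt + Nf xp))
        - tau *: (xp *m xp^T *m (A *m xp + Nf xp)),
      x = (l2norm xt)^-1 *: xt,
      forall i, vt i = vp i
        + tau *: ((1%:M - x *m x^T
                     - 2 *: \sum_(j < k | (j < i)%N) v j *m (v j)^T)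
                    *m Jmat E x *m vt i)
        - tau *: (vp i *m (vp i)^T *m Jmat E x *m vp i)
        + (tau * dotv (vt i) (force E x)) *: x
    & forall i,
        let vh := vt i - dotv (vt i) x *: x in
        let w := vh - \sum_(j < k | (j < i)%N) dotv vh (v j) *: v j in
        v i = (l2norm w)^-1 *: w].

Definition numerical_solution (R : realType) (d k : nat) (E : 'cV[R]_d -> R)
    (A : 'M[R]_d) (Nf : 'cV[R]_d -> 'cV[R]_d) (tau : R) (N : nat)
    (x0 : 'cV[R]_d) (v0 : 'I_k -> 'cV[R]_d)
    (xn : nat -> 'cV[R]_d) (vn : 'I_k -> nat -> 'cV[R]_d) : Prop :=
  [/\ xn 0%N = x0,
      forall i, vn i 0%N = v0 i
    & forall n, (1 <= n <= N)%N ->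
        semi_implicit_step E A Nf tau (xn n.-1) (fun i => vn i n.-1)
          (xn n) (fun i => vn i n)].

(* Main.v *)
Require Import Defs.
From mathcomp Require Import all_boot all_order all_algebra.
From mathcomp Require Import all_classical all_reals all_analysis.
From mathcomp Require Import ring lra.

(** Consistency and stability give first order convergence; the work is in
    consistency, because the scheme is implicit, uses the updated vectors in
    its projections, and renormalizes.

    Let [z = (x, v)] and [z' = f z] be the saddle dynamics. On orthonormal data
    the constraint functions |x|^2, (x, v_i) and (v_i, v_j) are first integrals
    of [f]: [dotv_x_rhs_x], [dotv_v_rhs_x], [dotv_v_rhs_v] and
    [dotv_v_rhs_v_lt], the last one by symmetry of the Hessian. A step of the
    scheme starting from orthonormal data produces unnormalized vectors equal
    to z + tau f(z) + O(tau^2), whose inner products therefore differ from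
    those of [z] by O(tau^2) only ([first_order_dot]). Hence the projections,
    the Gram-Schmidt sums and the normalizations are corrections of size
    O(tau^2) ([position_step], [direction_step]), the denominators do not
    vanish for small [tau], and the new vectors are again orthonormal
    ([next_admissible]). This is [local_error]: the scheme is an explicit Euler
    step up to a uniform O(tau^2), along orthonormal iterates.

    To have constants that do not depend on the step, all the data of a step
    are points of one type, filtered by the smallness of [tau], and vectors are
    functions on this type. An estimate u = O(r) along the filter ([domV]) then
    has by definition a constant shared by all steps. The same calculus, with
    the distance of two states in the role of [tau], shows that [f] is
    Lipschitz on bounded sets ([saddle_field_lipschitz]).

    The convergence argument ([one_step_convergence]) is the usual recursion
    e_(n+1) <= (1 + K tau) e_n + O(tau^2). The vector field is only locally
    Lipschitz, but the iterates are unit vectors, and the error bound, which is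
    less than 1/2 for small [tau], keeps the exact solution in the ball of
    radius 2 while the induction proceeds. *)

Import Order.TTheory GRing.Theory Num.Theory.
Import numFieldNormedType.Exports.

Local Open Scope classical_set_scope.
Local Open Scope ring_scope.

Set Implicit Arguments.
Unset Strict Implicit.
Unset Printing Implicit Defensive.

(** * Euclidean norm *)

Section EuclideanNorm.
Variables (R : realType) (d : nat).
Implicit Types (u v w : 'cV[R]_d) (a : R).

Lemma dotvE u w : dotv u w = \sum_i u i 0 * w i 0.
Proof. by rewrite /dotv mxE; apply: eq_bigr => i _; rewrite mxE. Qed.

Lemma dotvC u w : dotv u w = dotv w u.
Proof. by rewrite !dotvE; apply: eq_bigr => i _; rewrite mulrC. Qed.

Lemma dotvDr u v w : dotv u (v + w) = dotv u v + dotv u w.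
Proof. by rewrite /dotv mulmxDr mxE. Qed.

Lemma dotvZr a u w : dotv u (a *: w) = a * dotv u w.
Proof. by rewrite /dotv -scalemxAr mxE. Qed.

Lemma dotvNr u w : dotv u (- w) = - dotv u w.
Proof. by rewrite -scaleN1r dotvZr mulN1r. Qed.

Lemma dotv0r u : dotv u 0 = 0.
Proof. by rewrite -(scale0r 0) dotvZr mul0r. Qed.

Lemma dotv_sumr (I : Type) (r : seq I) (P : pred I) u (f : I -> 'cV[R]_d) :
  dotv u (\sum_(i <- r | P i) f i) = \sum_(i <- r | P i) dotv u (f i).
Proof.
exact: (big_morph (dotv u) (dotvDr u) (dotv0r u)).
Qed.

Lemma dotvDl u v w : dotv (u + v) w = dotv u w + dotv v w.
Proof. by rewrite dotvC dotvDr !(dotvC w). Qed.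

Lemma dotvZl a u w : dotv (a *: u) w = a * dotv u w.
Proof. by rewrite dotvC dotvZr dotvC. Qed.

Lemma dotvNl u w : dotv (- u) w = - dotv u w.
Proof. by rewrite dotvC dotvNr dotvC. Qed.

Lemma dotv_suml (I : Type) (r : seq I) (P : pred I) u (f : I -> 'cV[R]_d) :
  dotv (\sum_(i <- r | P i) f i) u = \sum_(i <- r | P i) dotv (f i) u.
Proof. by rewrite dotvC dotv_sumr; apply: eq_bigr => i _; rewrite dotvC. Qed.

Definition dotv_lin := (dotvDr, dotvDl, dotvNr, dotvNl, dotvZr, dotvZl).

Lemma dotvv_ge0 u : 0 <= dotv u u.
Proof. by rewrite dotvE sumr_ge0 // => i _; rewrite -expr2 sqr_ge0. Qed.

Lemma dotvv_eq0 u : dotv u u = 0 -> u = 0.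
Proof.
rewrite dotvE => /eqP; rewrite psumr_eq0; last first.
  by move=> i _; rewrite -expr2 sqr_ge0.
move=> /allP h; apply/matrixP => i j; rewrite ord1 mxE.
have /h := mem_index_enum i.
by rewrite implyTb mulf_eq0 orbb => /eqP.
Qed.

Lemma l2norm_ge0 u : 0 <= l2norm u.
Proof. exact: sqrtr_ge0. Qed.

Lemma sqr_l2norm u : l2norm u ^+ 2 = dotv u u.
Proof. by rewrite sqr_sqrtr ?dotvv_ge0. Qed.

Lemma l2norm_eq0 u : l2norm u = 0 -> u = 0.
Proof. by move=> h; apply: dotvv_eq0; rewrite -sqr_l2norm h expr0n. Qed.

Lemma l2normZ a u : l2norm (a *: u) = `|a| * l2norm u.
Proof.
by rewrite /l2norm dotvZl dotvZr mulrA -expr2 sqrtrM ?sqr_ge0// sqrtr_sqr.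
Qed.

Lemma l2norm0 : l2norm (0 : 'cV[R]_d) = 0.
Proof. by rewrite -(scale0r 0) l2normZ normr0 mul0r. Qed.

Lemma l2normN u : l2norm (- u) = l2norm u.
Proof. by rewrite -scaleN1r l2normZ normrN1 mul1r. Qed.

Lemma cauchy_schwarz u w : `|dotv u w| <= l2norm u * l2norm w.
Proof.
have [w0|wn0] := eqVneq (dotv w w) 0.
  by rewrite (dotvv_eq0 w0) dotv0r normr0 l2norm0 mulr0.
have w_gt0 : 0 < dotv w w by rewrite lt_neqAle eq_sym wn0 dotvv_ge0.
rewrite -(@ler_pXn2r _ 2%N) ?nnegrE ?normr_ge0 ?mulr_ge0 ?l2norm_ge0//.
rewrite exprMn !sqr_l2norm real_normK ?num_real//.
have := dotvv_ge0 (dotv w w *: u - dotv u w *: w).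
have -> : dotv (dotv w w *: u - dotv u w *: w) (dotv w w *: u - dotv u w *: w)
    = dotv w w * (dotv u u * dotv w w - dotv u w ^+ 2).
  by rewrite !dotv_lin (dotvC w u); ring.
by rewrite pmulr_rge0// subr_ge0.
Qed.

Lemma l2normD u w : l2norm (u + w) <= l2norm u + l2norm w.
Proof.
rewrite -(@ler_pXn2r _ 2%N) ?nnegrE ?addr_ge0 ?l2norm_ge0//.
rewrite sqr_l2norm sqrrD !sqr_l2norm !dotv_lin (dotvC w u).
have := cauchy_schwarz u w; have := ler_norm (dotv u w); lra.
Qed.

Lemma coord_le_l2norm u i : `|u i 0| <= l2norm u.
Proof.
rewrite -(@ler_pXn2r _ 2%N) ?nnegrE ?normr_ge0 ?l2norm_ge0//.
rewrite sqr_l2norm real_normK ?num_real// dotvE (bigD1 i)//= -expr2 lerDl.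
by rewrite sumr_ge0// => j _; rewrite -expr2 sqr_ge0.
Qed.

Lemma l2norm_le_sum u : l2norm u <= \sum_i `|u i 0|.
Proof.
have s0 : 0 <= \sum_i `|u i 0| by apply: sumr_ge0.
rewrite -(@ler_pXn2r _ 2%N) ?nnegrE ?l2norm_ge0//.
rewrite sqr_l2norm dotvE expr2 mulr_suml ler_sum// => i _.
rewrite (le_trans (ler_norm _))// normrM ler_wpM2l// (bigD1 i)//= lerDl.
by rewrite sumr_ge0.
Qed.

Lemma mulmx_bounded (A : 'M[R]_d) :
  exists2 C, 0 <= C & forall u, l2norm (A *m u) <= C * l2norm u.
Proof.
exists (\sum_i \sum_j `|A i j|) => [|u].
  by apply: sumr_ge0 => i _; apply: sumr_ge0.
rewrite (le_trans (l2norm_le_sum _))// mulr_suml ler_sum// => i _.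
rewrite mxE (le_trans (ler_norm_sum _ _ _))// mulr_suml ler_sum// => j _.
by rewrite normrM ler_wpM2l// coord_le_l2norm.
Qed.

(** The supremum defining the operator norm is over a bounded set, so that it
    controls every vector and not only the unit ones. *)
Lemma l2norm_mulmx (A : 'M[R]_d) u : l2norm (A *m u) <= l2opnorm A * l2norm u.
Proof.
have [u0|un0] := eqVneq (l2norm u) 0.
  by rewrite (l2norm_eq0 u0) mulmx0 l2norm0 mulr0.
have nu : l2norm ((l2norm u)^-1 *: u) = 1.
  by rewrite l2normZ ger0_norm ?invr_ge0 ?l2norm_ge0// mulVf.
have -> : A *m u = l2norm u *: (A *m ((l2norm u)^-1 *: u)).
  by rewrite -scalemxAr scalerA divff// scale1r.
rewrite l2normZ ger0_norm ?l2norm_ge0// mulrC ler_wpM2r ?l2norm_ge0//.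
apply: ub_le_sup; last by exists ((l2norm u)^-1 *: u).
have [C C0 hC] := mulmx_bounded A.
by exists C => _ [w /= w1 <-]; rewrite (le_trans (hC w))// w1 mulr1.
Qed.

End EuclideanNorm.

(** * Uniform order calculus *)

Lemma sub_telescope (V : zmodType) (a b c : V) : a - b = (c - b) + (a - c).
Proof. by rewrite [RHS]addrC subrKA. Qed.

Section UniformBounds.
Variables (R : realType) (W : Type) (F : set_system W).
Context {FF : Filter F}.
Implicit Types (r s a b : W -> R).

(** [a = O(r)] along [F]. When the points of [W] carry all the data of a
    problem, the existential constant is a uniform one. *)
Definition domR r a := exists C, \forall w \near F, `|a w| <= C * r w.

Lemma domR_ge0 r a : domR r a ->
  exists2 C, 0 <= C & \forall w \near F, `|a w| <= C * `|r w|.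
Proof.
move=> [C hC]; exists `|C| => //; near=> w.
rewrite (le_trans (near hC w _))// -normrM ler_norm //.
Unshelve. all: by end_near. Qed.

Lemma domR_trans s r a : domR r a -> domR s r -> domR s a.
Proof.
move=> /domR_ge0[C C0 hC] [D hD]; exists (C * D); near=> w.
rewrite (le_trans (near hC w _))// -mulrA ler_wpM2l//.
exact: (near hD w).
Unshelve. all: by end_near. Qed.

Lemma domR_near r a b :
  (\forall w \near F, a w = b w) -> domR r b -> domR r a.
Proof.
move=> ab [C hC]; exists C; near=> w.
rewrite (near ab w)//; exact: (near hC w).
Unshelve. all: by end_near. Qed.

Lemma domR0 r : domR r (fun=> 0).
Proof. by exists 0; near=> w; rewrite normr0 mul0r.
Unshelve. all: by end_near. Qed.

Lemma domRc c : domR (fun=> 1) (fun=> c).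
Proof. by exists `|c|; near=> w; rewrite mulr1.
Unshelve. all: by end_near. Qed.

Lemma domRD r a b : domR r a -> domR r b -> domR r (fun w => a w + b w).
Proof.
move=> [C hC] [D hD]; exists (C + D); near=> w.
by rewrite mulrDl (le_trans (ler_normD _ _))// lerD//;
  [exact: (near hC w)|exact: (near hD w)].
Unshelve. all: by end_near. Qed.

Lemma domRM r s a b : domR r a -> domR s b ->
  domR (fun w => r w * s w) (fun w => a w * b w).
Proof.
move=> [C hC] [D hD]; exists (C * D); near=> w.
by rewrite normrM mulrACA ler_pM//; [exact: (near hC w)|exact: (near hD w)].
Unshelve. all: by end_near. Qed.

Lemma domR1M r a b : domR (fun=> 1) a -> domR r b -> domR r (fun w => a w * b w).
Proof.
move=> ha hb; have [C hC] := domRM ha hb; exists C.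
near=> w; rewrite -[r _]mul1r; exact: (near hC w).
Unshelve. all: by end_near. Qed.

Variable d : nat.
Implicit Types (u v : W -> 'cV[R]_d).

Definition domV r u := domR r (fun w => l2norm (u w)).

Lemma domV_trans s r u : domV r u -> domR s r -> domV s u.
Proof. exact: domR_trans. Qed.

Lemma domV_near r u v :
  (\forall w \near F, u w = v w) -> domV r v -> domV r u.
Proof. by move=> uv; apply: domR_near; apply: filterS uv => w ->. Qed.

Lemma domV0 r : domV r (fun=> 0).
Proof. by rewrite /domV l2norm0; exact: domR0. Qed.

Lemma domVc (c : 'cV[R]_d) : domV (fun=> 1) (fun=> c).
Proof. exact: domRc. Qed.

Lemma domV_le r a u : (\forall w \near F, l2norm (u w) <= `|a w|) ->
  domR r a -> domV r u.
Proof.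
move=> ua [C hC]; exists C; near=> w.
rewrite ger0_norm ?l2norm_ge0// (le_trans (near ua w _))//; exact: (near hC w).
Unshelve. all: by end_near. Qed.

Lemma domVD r u v : domV r u -> domV r v -> domV r (fun w => u w + v w).
Proof.
move=> hu hv; apply: domV_le (domRD hu hv); near=> w.
by rewrite (le_trans (l2normD _ _))// ler_norm.
Unshelve. all: by end_near. Qed.

Lemma domVZ r s a u : domR r a -> domV s u ->
  domV (fun w => r w * s w) (fun w => a w *: u w).
Proof.
move=> ha hu; apply: domV_le (domRM ha hu); near=> w.
by rewrite l2normZ normrM [X in _ <= _ * X]ger0_norm ?l2norm_ge0.
Unshelve. all: by end_near. Qed.

Lemma domVZl r a u : domR r a -> domV (fun=> 1) u ->
  domV r (fun w => a w *: u w).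
Proof.
move=> ha hu; have [C hC] := domVZ ha hu; exists C.
near=> w; rewrite -[r _]mulr1; exact: (near hC w).
Unshelve. all: by end_near. Qed.

Lemma domVZr r a u : domR (fun=> 1) a -> domV r u ->
  domV r (fun w => a w *: u w).
Proof.
move=> ha hu; have [C hC] := domVZ ha hu; exists C.
near=> w; rewrite -[r _]mul1r; exact: (near hC w).
Unshelve. all: by end_near. Qed.

Lemma domVN r u : domV r u -> domV r (fun w => - u w).
Proof.
move=> hu; apply: domV_near (domVZr (domRc (-1)) hu).
by near=> w; rewrite scaleN1r.
Unshelve. all: by end_near. Qed.

Lemma domV_sum (I : Type) (l : seq I) (P : pred I) r (u : I -> W -> 'cV[R]_d) :
  (forall i, P i -> domV r (u i)) ->
  domV r (fun w => \sum_(i <- l | P i) u i w).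
Proof.
move=> h; elim: l => [|i l ih].
  by apply: domV_near (domV0 r); near=> w; rewrite big_nil.
case/boolP: (P i) => Pi.
  apply: domV_near (domVD (h _ Pi) ih).
  by near=> w; rewrite big_cons Pi.
by apply: domV_near ih; near=> w; rewrite big_cons (negbTE Pi).
Unshelve. all: by end_near. Qed.

Lemma domV_dot r s u v : domV r u -> domV s v ->
  domR (fun w => r w * s w) (fun w => dotv (u w) (v w)).
Proof.
move=> hu hv; have [C hC] := domRM hu hv; exists C; near=> w.
apply: le_trans (near hC w _) => //.
by rewrite [leRHS]ger0_norm ?mulr_ge0 ?l2norm_ge0// cauchy_schwarz.
Unshelve. all: by end_near. Qed.

Lemma domV1_dot r u v : domV (fun=> 1) u -> domV r v ->
  domR r (fun w => dotv (u w) (v w)).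
Proof.
move=> hu hv; have [C hC] := domV_dot hu hv; exists C.
near=> w; rewrite -[r _]mul1r; exact: (near hC w).
Unshelve. all: by end_near. Qed.

Lemma domV_dot1 r u v : domV r u -> domV (fun=> 1) v ->
  domR r (fun w => dotv (u w) (v w)).
Proof.
move=> hu hv; apply: domR_near (domV1_dot hv hu); near=> w; exact: dotvC.
Unshelve. all: by end_near. Qed.

Definition congR r a b :=
  [/\ domR r (fun w => a w - b w), domR (fun=> 1) a & domR (fun=> 1) b].

(** Congruence modulo [r] between bounded families; boundedness is part of the
    relation because products are compatible with it only in that case. *)
Definition congV r u v :=
  [/\ domV r (fun w => u w - v w), domV (fun=> 1) u & domV (fun=> 1) v].

Lemma congR_refl r a : domR (fun=> 1) a -> congR r a a.
Proof.
by split=> //; apply: domR_near (domR0 r); near=> w; rewrite subrr.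
Unshelve. all: by end_near. Qed.

Lemma congV_refl r u : domV (fun=> 1) u -> congV r u u.
Proof.
by split=> //; apply: domV_near (domV0 r); near=> w; rewrite subrr.
Unshelve. all: by end_near. Qed.

Lemma congVD r u u' v v' : congV r u u' -> congV r v v' ->
  congV r (fun w => u w + v w) (fun w => u' w + v' w).
Proof.
move=> [uu u1 u'1] [vv v1 v'1]; split; [|exact: domVD|exact: domVD].
by apply: domV_near (domVD uu vv); near=> w; rewrite opprD addrACA.
Unshelve. all: by end_near. Qed.

Lemma congVN r u u' : congV r u u' ->
  congV r (fun w => - u w) (fun w => - u' w).
Proof.
move=> [uu u1 u'1]; split; [|exact: domVN|exact: domVN].
by apply: domV_near (domVN uu); near=> w; rewrite opprD.
Unshelve. all: by end_near. Qed.

Lemma congVZ r a a' u u' : congR r a a' -> congV r u u' ->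
  congV r (fun w => a w *: u w) (fun w => a' w *: u' w).
Proof.
move=> [aa a1 a'1] [uu u1 u'1]; split; [|exact: domVZl|exact: domVZl].
apply: domV_near (domVD (domVZl aa u'1) (domVZr a1 uu)).
by near=> w; rewrite scalerBl scalerBr; exact: sub_telescope.
Unshelve. all: by end_near. Qed.

Lemma congV_sum (I : Type) (l : seq I) (P : pred I) r
    (u v : I -> W -> 'cV[R]_d) :
  (forall i, P i -> congV r (u i) (v i)) ->
  congV r (fun w => \sum_(i <- l | P i) u i w)
          (fun w => \sum_(i <- l | P i) v i w).
Proof.
move=> h; split; last 2 first.
- by apply: domV_sum => i /h[].
- by apply: domV_sum => i /h[].
apply: domV_near (domV_sum l (P := P) (u := fun i w => u i w - v i w) _).
  by near=> w; rewrite sumrB.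
by move=> i /h[].
Unshelve. all: by end_near. Qed.

Lemma congR_dot r u u' v v' : congV r u u' -> congV r v v' ->
  congR r (fun w => dotv (u w) (v w)) (fun w => dotv (u' w) (v' w)).
Proof.
move=> [uu u1 u'1] [vv v1 v'1]; split; try exact: domV1_dot.
apply: domR_near (domRD (domV1_dot v1 uu) (domV1_dot u'1 vv)).
near=> w; rewrite !dotv_lin (dotvC (v w)) (dotvC (v w)); ring.
Unshelve. all: by end_near. Qed.

End UniformBounds.

(** * The saddle vector field *)

Lemma mulmx_telescope (R : realType) (d : nat) (M M' : 'M[R]_d)
    (u u' : 'cV[R]_d) :
  M *m u - M' *m u' = (M *m u' - M' *m u') + M *m (u - u').
Proof. by rewrite [X in _ = _ + X]mulmxBr; exact: sub_telescope. Qed.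

Section Flip.
Variables (R : realType) (d k : nat).
Implicit Types (x y : 'cV[R]_d) (v : 'I_k -> 'cV[R]_d) (P : pred 'I_k).

(** For orthonormal [v], the reflection that reverses the span of the [v j],
    [j] in [P]. *)
Definition flip v P y := y - 2 *: \sum_(j < k | P j) dotv (v j) y *: v j.

Lemma mul_outer x y : x *m x^T *m y = dotv x y *: x.
Proof. by rewrite -mulmxA [x^T *m y]mx11_scalar mul_mx_scalar. Qed.

Lemma mul_flip v P y :
  (1%:M - 2 *: \sum_(j < k | P j) v j *m (v j)^T) *m y = flip v P y.
Proof.
rewrite /flip mulmxBl mul1mx -scalemxAl mulmx_suml.
by under eq_bigr do rewrite mul_outer.
Qed.

Lemma mul_outer_flip x v P (M : 'M[R]_d) y :
  (1%:M - x *m x^T - 2 *: \sum_(j < k | P j) v j *m (v j)^T) *m M *m y =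
  flip v P (M *m y) - dotv x (M *m y) *: x.
Proof. by rewrite -mulmxA addrAC mulmxBl mul_flip mul_outer. Qed.

Lemma dotv_flip v P x y :
  dotv x (flip v P y) =
  dotv x y - 2 * \sum_(j < k | P j) dotv (v j) y * dotv x (v j).
Proof.
rewrite /flip dotvDr dotvNr dotvZr dotv_sumr.
by under eq_bigr do rewrite dotvZr.
Qed.

Lemma dotv_flip_orthogonal v P x y : (forall j, P j -> dotv x (v j) = 0) ->
  dotv x (flip v P y) = dotv x y.
Proof.
move=> h; rewrite dotv_flip big1 ?mulr0 ?subr0// => j /h ->.
by rewrite mulr0.
Qed.

Lemma dotv_flip_member v (P : pred 'I_k) i y :
  (forall j, dotv (v i) (v j) = (i == j)%:R) -> P i ->
  dotv (v i) (flip v P y) = - dotv (v i) y.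
Proof.
move=> h Pi; rewrite dotv_flip (bigD1 i)//= h eqxx mulr1 big1.
  by rewrite addr0; ring.
by move=> j /andP[_ ji]; rewrite h eq_sym (negbTE ji) mulr0.
Qed.

Variable E : 'cV[R]_d -> R.

Lemma saddle_rhs_xE x v : saddle_rhs_x E x v =
  flip v predT (force E x) - dotv x (force E x) *: x.
Proof.
by rewrite /saddle_rhs_x addrAC mulmxBl mul_flip mul_outer.
Qed.

Lemma saddle_rhs_vE x v i : saddle_rhs_v E x v i =
  flip v (fun j => (j < i)%N) (Jmat E x *m v i)
  - dotv x (Jmat E x *m v i) *: x
  - dotv (v i) (Jmat E x *m v i) *: v i
  + dotv (v i) (force E x) *: x.
Proof.
rewrite /saddle_rhs_v; congr (_ + _).
rewrite -mulmxA 3!mulmxBl mul1mx !mul_outer -mul_flip mulmxBl mul1mx.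
by rewrite [LHS]addrAC; congr (_ - _); rewrite addrAC.
Qed.

End Flip.

Section SaddleField.
Variables (R : realType) (d k : nat) (E : 'cV[R]_d -> R).
Variables (A : 'M[R]_d) (Nf : 'cV[R]_d -> 'cV[R]_d) (L : R).
Hypothesis hA : assumptionA E A Nf L.

Lemma force_split x : force E x = A *m x + Nf x.
Proof. by case: hA. Qed.

Lemma nonlinear_lipschitz x y : l2norm (Nf x - Nf y) <= L * l2norm (x - y).
Proof. by case: hA => _ /(_ y x) + _; rewrite !ge_max => /and3P[]. Qed.

Lemma linear_lipschitz x y : l2norm (A *m x - A *m y) <= L * l2norm (x - y).
Proof. by case: hA => _ /(_ y x) + _; rewrite !ge_max => /and3P[]. Qed.

Lemma force_lipschitz x y :
  l2norm (force E x - force E y) <= (L + L) * l2norm (x - y).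
Proof.
rewrite !force_split opprD addrACA mulrDl (le_trans (l2normD _ _))//.
by apply: lerD; [exact: linear_lipschitz|exact: nonlinear_lipschitz].
Qed.

Lemma Jmat_lipschitz x y u :
  l2norm (Jmat E x *m u - Jmat E y *m u) <= L * l2norm (x - y) * l2norm u.
Proof.
rewrite -mulmxBl (le_trans (l2norm_mulmx _ _))// ler_wpM2r ?l2norm_ge0//.
by case: hA => _ /(_ y x) + _; rewrite !ge_max => /and3P[].
Qed.

Variables (W : Type) (F : set_system W).
Context {FF : Filter F}.
Implicit Types (r : W -> R) (x y u : W -> 'cV[R]_d).

Lemma domV_lipschitz (f : 'cV[R]_d -> 'cV[R]_d) C r x x' :
  (forall a b, l2norm (f a - f b) <= C * l2norm (a - b)) ->
  domV F r (fun w => x w - x' w) -> domV F r (fun w => f (x w) - f (x' w)).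
Proof.
move=> fC h; apply: domV_le (domR1M (domRc C) h).
by near=> w; rewrite (le_trans (fC _ _))// ler_norm.
Unshelve. all: by end_near. Qed.

(** Boundedness of the images comes from comparison with the value at [0]. *)
Lemma congV_lipschitz (f : 'cV[R]_d -> 'cV[R]_d) C r x x' :
  (forall a b, l2norm (f a - f b) <= C * l2norm (a - b)) ->
  congV F r x x' -> congV F r (fun w => f (x w)) (fun w => f (x' w)).
Proof.
move=> fC [xx x1 x'1].
have bnd y : domV F (fun=> 1) y -> domV F (fun=> 1) (fun w => f (y w)).
  move=> h; apply: (domV_near (v := fun w => f (y w) - f 0 + f 0)).
    by near=> w; rewrite subrK.
  apply: domVD (domVc _); apply: (@domV_lipschitz f C _ y (fun=> 0)) => //.
  by apply: domV_near h; near=> w; rewrite subr0.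
by split; [exact: domV_lipschitz xx|exact: bnd|exact: bnd].
Unshelve. all: by end_near. Qed.

Lemma congV_force r x x' : congV F r x x' ->
  congV F r (fun w => force E (x w)) (fun w => force E (x' w)).
Proof. exact: congV_lipschitz force_lipschitz. Qed.

Lemma domV_Jmat r x u : domV F (fun=> 1) x -> domV F r u ->
  domV F r (fun w => Jmat E (x w) *m u w).
Proof.
move=> hx hu; have [C _ hC] := mulmx_bounded (Jmat E 0).
have hb : domR F (fun=> 1) (fun w => L * l2norm (x w) + C).
  by apply: domRD (domRc _); apply: domR1M (domRc _) hx.
apply: domV_le (domR1M hb hu); near=> w.
rewrite -(subrK (Jmat E 0 *m u w) (Jmat E (x w) *m u w)).
rewrite (le_trans (l2normD _ _))// (le_trans (lerD (Jmat_lipschitz _ _ _) (hC _)))//.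
by rewrite subr0 -mulrDl ler_norm.
Unshelve. all: by end_near. Qed.

Lemma congV_Jmat r x x' u u' : congV F r x x' -> congV F r u u' ->
  congV F r (fun w => Jmat E (x w) *m u w) (fun w => Jmat E (x' w) *m u' w).
Proof.
move=> [xx x1 x'1] [uu u1 u'1]; split; [|exact: domV_Jmat|exact: domV_Jmat].
apply: (domV_near (v := fun w => (Jmat E (x w) *m u' w - Jmat E (x' w) *m u' w)
  + Jmat E (x w) *m (u w - u' w))).
  near=> w; exact: mulmx_telescope.
apply: domVD; last exact: domV_Jmat.
have h : domR F r (fun w => L * (l2norm (u' w) * l2norm (x w - x' w))).
  by apply: domR1M (domRc _) _; apply: domR1M.
apply: domV_le h; near=> w.
by rewrite mulrA mulrAC (le_trans (Jmat_lipschitz _ _ _))// ler_norm.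
Unshelve. all: by end_near. Qed.

Implicit Types (v : 'I_k -> W -> 'cV[R]_d) (P : pred 'I_k).

Lemma domV_flip r v P u : (forall j, P j -> domV F (fun=> 1) (v j)) ->
  domV F r u -> domV F r (fun w => flip (fun j => v j w) P (u w)).
Proof.
move=> hv hu; apply: domVD => //; apply: domVN; apply: domVZr (domRc _) _.
by apply: domV_sum => j /hv vj; apply: domVZl => //; exact: domV1_dot.
Qed.

Lemma congV_flip r v v' P u u' : (forall j, P j -> congV F r (v j) (v' j)) ->
  congV F r u u' ->
  congV F r (fun w => flip (fun j => v j w) P (u w))
            (fun w => flip (fun j => v' j w) P (u' w)).
Proof.
move=> hv hu; apply: congVD => //; apply: congVN.
apply: congVZ (congR_refl _ (domRc _)) _.
by apply: congV_sum => j /hv vj; apply: congVZ => //; exact: congR_dot.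
Qed.

(** Used both with [r] the distance of two states, for local Lipschitz bounds,
    and with [r] the step size, for consistency. *)
Lemma congV_saddle_rhs_x r x x' v v' : congV F r x x' ->
  (forall j, congV F r (v j) (v' j)) ->
  congV F r (fun w => saddle_rhs_x E (x w) (fun j => v j w))
            (fun w => saddle_rhs_x E (x' w) (fun j => v' j w)).
Proof.
move=> hx hv; under eq_fun do rewrite saddle_rhs_xE.
under [X in congV _ _ _ X]eq_fun do rewrite saddle_rhs_xE.
have hF := congV_force hx.
apply: congVD; first by apply: congV_flip => // j _; exact: hv.
by apply: congVN; apply: congVZ => //; exact: congR_dot.
Qed.

Lemma congV_saddle_rhs_v r x x' v v' i : congV F r x x' ->
  (forall j, congV F r (v j) (v' j)) ->
  congV F r (fun w => saddle_rhs_v E (x w) (fun j => v j w) i)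
            (fun w => saddle_rhs_v E (x' w) (fun j => v' j w) i).
Proof.
move=> hx hv; under eq_fun do rewrite saddle_rhs_vE.
under [X in congV _ _ _ X]eq_fun do rewrite saddle_rhs_vE.
have hF := congV_force hx; have hJ := congV_Jmat hx (hv i).
apply: congVD; last by apply: congVZ => //; exact: congR_dot.
apply: congVD; last by apply: congVN; apply: congVZ => //; exact: congR_dot.
apply: congVD; last by apply: congVN; apply: congVZ => //; exact: congR_dot.
by apply: congV_flip => // j _; exact: hv.
Qed.

End SaddleField.

(** * First order expansions *)

Section FirstOrder.
Variables (R : realType) (W : Type) (F : set_system W).
Context {FF : Filter F}.
Variable tau : W -> R.
Hypothesis tau_ge0 : \forall w \near F, 0 <= tau w.
Hypothesis tau_small : forall e, 0 < e -> \forall w \near F, tau w <= e.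
Variable d : nat.
Implicit Types (u f g p q : W -> 'cV[R]_d).

Lemma domR_tau : domR F tau tau.
Proof.
by exists 1; near=> w; rewrite mul1r ger0_norm//; near: w.
Unshelve. all: by end_near. Qed.

Lemma domR1_tau : domR F (fun=> 1) tau.
Proof.
exists 1; near=> w; rewrite mulr1 ger0_norm; [near: w|by near: w].
exact: tau_small.
Unshelve. all: by end_near. Qed.

Lemma domR_tau2 : domR F tau (fun w => tau w * tau w).
Proof. exact: domR1M domR1_tau domR_tau. Qed.

Lemma domR_tau2_small a e : 0 < e -> domR F (fun w => tau w * tau w) a ->
  \forall w \near F, `|a w| <= e.
Proof.
move=> e0 h; have [C C0 hC] := domR_ge0 (domR_trans h domR_tau2).
near=> w; rewrite (le_trans (near hC w _))// ger0_norm; last by near: w.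
have : tau w <= e / (C + 1).
  by near: w; apply: tau_small; rewrite divr_gt0// ltr_wpDl.
rewrite ler_pdivlMr ?ltr_wpDl// => h1.
have : 0 <= tau w by near: w.
by nra.
Unshelve. all: by end_near. Qed.

(** The unknown [u] of an implicit step enters the increment [g] with at most
    linear growth, so that for small [tau] the right-hand side can be absorbed
    by the left-hand side; in particular [u] is bounded. *)
Lemma implicit_step u p g : (\forall w \near F, u w = p w + tau w *: g w) ->
  domV F (fun=> 1) p -> domV F (fun w => 1 + l2norm (u w)) g ->
  congV F tau u p.
Proof.
move=> hu p1 hg.
have u1 : domV F (fun=> 1) u.
  have [C C0 hC] := domR_ge0 hg; have [B hB] := p1.
  exists (2 * B + 1); near=> w.
  have hB1 : `|l2norm (p w)| <= B * 1 by near: w.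
  have hC1 : `|l2norm (g w)| <= C * `|1 + l2norm (u w)| by near: w.
  rewrite mulr1 ger0_norm ?l2norm_ge0// in hB1.
  rewrite !ger0_norm ?addr_ge0 ?l2norm_ge0// in hC1.
  rewrite mulr1 ger0_norm ?l2norm_ge0//.
  have hle : l2norm (u w) <= l2norm (p w) + tau w * l2norm (g w).
    rewrite {1}(near hu w _)// (le_trans (l2normD _ _))// l2normZ ger0_norm//.
    by near: w.
  have tw0 : 0 <= tau w by near: w.
  (* This makes tau C at most 1/2, which absorbs half of the norm of u. *)
  have : tau w <= 1 / (2 * (C + 1)).
    by near: w; apply: tau_small; rewrite divr_gt0// mulr_gt0// ltr_wpDl.
  rewrite ler_pdivlMr ?mulr_gt0 ?ltr_wpDl// => htau.
  have := l2norm_ge0 (u w); set z := l2norm (u w) in hle hC1 *.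
  have h3 : tau w * l2norm (g w) <= tau w * C * (1 + z).
    by rewrite -mulrA ler_wpM2l.
  move=> z0.
  have h4 : tau w * C * (1 + z) <= 2^-1 * (1 + z).
    apply: ler_wpM2r; first lra.
    nra.
  lra.
split=> //.
apply: (domV_near (v := fun w => tau w *: g w)).
  by near=> w; rewrite {1}(near hu w _)// addrC addKr.
apply: domVZl domR_tau _; apply: domV_trans hg _.
by apply: domRD (domRc 1) _.
Unshelve. all: by end_near. Qed.

Lemma first_order_step u p f g :
  (\forall w \near F, u w = p w + tau w *: g w) -> congV F tau g f ->
  domV F (fun w => tau w * tau w) (fun w => u w - (p w + tau w *: f w)).
Proof.
move=> hu [gf _ _]; apply: (domV_near _ (domVZ domR_tau gf)); near=> w.
by rewrite (near hu w _)// opprD addrACA subrr add0r scalerBr.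
Unshelve. all: by end_near. Qed.

Lemma domV1_first_order p f : domV F (fun=> 1) p -> domV F (fun=> 1) f ->
  domV F (fun=> 1) (fun w => p w + tau w *: f w).
Proof. by move=> p1 f1; apply: domVD => //; apply: domVZl domR1_tau _. Qed.

Lemma congV_first_order u p f : domV F (fun=> 1) p -> domV F (fun=> 1) f ->
  domV F (fun w => tau w * tau w) (fun w => u w - (p w + tau w *: f w)) ->
  congV F (fun w => tau w * tau w) u (fun w => p w + tau w *: f w) /\
  congV F tau u p.
Proof.
move=> p1 f1 huf; have pf1 := domV1_first_order p1 f1.
have huf' : domV F tau (fun w => u w - (p w + tau w *: f w)).
  exact: domV_trans huf domR_tau2.
have up : domV F tau (fun w => u w - p w).
  apply: (domV_near _ (domVD huf' (domVZl domR_tau f1))); near=> w.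
  by rewrite opprD addrA subrK.
have u1 : domV F (fun=> 1) u.
  apply: (domV_near _ (domVD (domV_trans up domR1_tau) p1)); near=> w.
  by rewrite subrK.
by split; split.
Unshelve. all: by end_near. Qed.

(** The hypothesis on [f] and [g] says that the inner product has derivative
    zero in the direction [(f, g)], so that only second order terms remain. *)
Lemma first_order_dot a b p q f g c :
  domV F (fun=> 1) p -> domV F (fun=> 1) q ->
  domV F (fun=> 1) f -> domV F (fun=> 1) g ->
  domV F (fun w => tau w * tau w) (fun w => a w - (p w + tau w *: f w)) ->
  domV F (fun w => tau w * tau w) (fun w => b w - (q w + tau w *: g w)) ->
  (\forall w \near F, dotv (p w) (q w) = c) ->
  (\forall w \near F, dotv (p w) (g w) + dotv (f w) (q w) = 0) ->
  domR F (fun w => tau w * tau w) (fun w => dotv (a w) (b w) - c).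
Proof.
move=> p1 q1 f1 g1 ha hb pq pgfq.
have [ha' _] := congV_first_order p1 f1 ha.
have [hb' _] := congV_first_order q1 g1 hb.
have [hab _ _] := congR_dot ha' hb'.
have h : domR F (fun w => tau w * tau w)
    (fun w => dotv (f w) (g w) * (tau w * tau w)).
  by apply: domR1M (domV1_dot f1 g1) _; exact: domRM domR_tau domR_tau.
apply: (domR_near _ (domRD hab h)); near=> w.
have e1 : dotv (p w) (q w) = c by near: w.
have e2 : dotv (p w) (g w) + dotv (f w) (q w) = 0 by near: w.
rewrite -e1 !dotv_lin.
have -> : dotv (f w) (q w) = - dotv (p w) (g w).
  by apply/eqP; rewrite -addr_eq0 addrC e2.
ring.
Unshelve. all: by end_near. Qed.

(** A tangential step leaves the unit sphere only at second order, so that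
    normalizing is a second order correction. *)
Lemma normalized_step u p f :
  domV F (fun w => tau w * tau w) (fun w => u w - (p w + tau w *: f w)) ->
  (\forall w \near F, l2norm (p w) = 1) -> domV F (fun=> 1) f ->
  (\forall w \near F, dotv (p w) (f w) = 0) ->
  domV F (fun w => tau w * tau w)
    (fun w => (l2norm (u w))^-1 *: u w - (p w + tau w *: f w)) /\
  \forall w \near F, l2norm ((l2norm (u w))^-1 *: u w) = 1.
Proof.
move=> huf pn f1 pf.
have p1 : domV F (fun=> 1) p.
  by exists 1; near=> w; rewrite (near pn w _)// normr1 mulr1.
have huu : domR F (fun w => tau w * tau w) (fun w => dotv (u w) (u w) - 1).
  apply: (first_order_dot (p := p) (q := p) (f := f) (g := f)) => //.
    by near=> w; rewrite -sqr_l2norm (near pn w _)// expr1n.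
  by near=> w; rewrite (dotvC (f w)) (near pf w _)// addr0.
(* Any bound below 1 on the defect keeps the norm of u away from 0. *)
have h2 : (0 : R) < 2^-1 by rewrite invr_gt0.
have hsmall := domR_tau2_small h2 huu.
have upos : \forall w \near F, 0 < l2norm (u w).
  near=> w; rewrite lt_neqAle l2norm_ge0 andbT; apply/eqP => u0.
  have : `|dotv (u w) (u w) - 1| <= 2^-1 by near: w.
  by rewrite -sqr_l2norm -u0 expr0n/= sub0r normrN normr1; lra.
split; last first.
  near=> w; rewrite l2normZ ger0_norm ?invr_ge0 ?l2norm_ge0// mulVf//.
  by rewrite gt_eqF//; near: w.
have huv : domV F (fun w => tau w * tau w)
    (fun w => (l2norm (u w))^-1 *: u w - u w).
  apply: domV_le huu; near=> w.
  have u0 : 0 < l2norm (u w) by near: w.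
  rewrite -[X in _ *: _ - X]scale1r -scalerBl l2normZ -sqr_l2norm.
  rewrite -{2}(ger0_norm (ltW u0)) -normrM mulrBl mulVf ?gt_eqF// mul1r.
  (* |1 - |u|| <= |1 - |u|^2| since 1 + |u| >= 1. *)
  rewrite (_ : _ ^+ 2 - 1 = - ((1 - l2norm (u w)) * (1 + l2norm (u w)))); last by ring.
  rewrite normrN normrM ler_peMr//.
  by rewrite ger0_norm ?lerDl ?addr_ge0 ?ltW.
apply: (domV_near _ (domVD huv huf)); near=> w.
by rewrite addrA subrK.
Unshelve. all: by end_near. Qed.

End FirstOrder.

(** * One step of the semi-implicit scheme *)

(** The saddle field is tangent to the manifold of orthonormal data: it kills
    the differentials of the inner products. *)
Section Tangency.
Variables (R : realType) (d k : nat) (E : 'cV[R]_d -> R).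
Hypothesis J_sym : forall x, (Jmat E x)^T = Jmat E x.
Variables (x : 'cV[R]_d) (v : 'I_k -> 'cV[R]_d).
Hypothesis xv : admissible_data x v.

Let fx := saddle_rhs_x E x v.
Let fv := saddle_rhs_v E x v.

Let xx : dotv x x = 1.
Proof. by case: xv => x1 _ _; rewrite -sqr_l2norm x1 expr1n. Qed.

Let vv i j : dotv (v i) (v j) = (i == j)%:R.
Proof. by case: xv. Qed.

Let vx i : dotv x (v i) = 0.
Proof. by case: xv. Qed.

Lemma dotv_saddle_rhs_x u :
  dotv u fx = dotv u (flip v predT (force E x)) - dotv x (force E x) * dotv u x.
Proof. by rewrite /fx saddle_rhs_xE dotvDr dotvNr dotvZr. Qed.

Lemma dotv_saddle_rhs_v u i : dotv u (fv i) =
  dotv u (flip v (fun j => (j < i)%N) (Jmat E x *m v i))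
  - dotv x (Jmat E x *m v i) * dotv u x
  - dotv (v i) (Jmat E x *m v i) * dotv u (v i)
  + dotv (v i) (force E x) * dotv u x.
Proof.
rewrite /fv saddle_rhs_vE dotvDr dotvZr; congr (_ + _).
by rewrite 2!dotvDr 2!dotvNr 2!dotvZr.
Qed.

Lemma dotv_x_rhs_x : dotv x fx = 0.
Proof.
by rewrite dotv_saddle_rhs_x dotv_flip_orthogonal// xx mulr1 subrr.
Qed.

Lemma dotv_v_rhs_x i : dotv (v i) fx + dotv (fv i) x = 0.
Proof.
rewrite (dotvC (fv i)) dotv_saddle_rhs_x dotv_saddle_rhs_v.
rewrite dotv_flip_member// dotv_flip_orthogonal//.
rewrite (dotvC (v i) x) !vx xx; ring.
Qed.

Lemma dotv_v_rhs_v i : dotv (v i) (fv i) = 0.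
Proof.
rewrite dotv_saddle_rhs_v dotv_flip_orthogonal; last first.
  by move=> j ji; rewrite vv; case: eqP ji => // ->; rewrite ltnn.
by rewrite (dotvC (v i) x) vx vv eqxx !mulr0 mulr1; ring.
Qed.

(** The flip by the earlier directions acts on [v j] in the equation of [v i]
    but fixes [v i] in the equation of [v j]; this leaves the two pairings of
    the Hessian with [v i] and [v j], with opposite signs, and they cancel by
    symmetry. *)
Lemma dotv_v_rhs_v_lt (i j : 'I_k) : (j < i)%N ->
  dotv (v i) (fv j) + dotv (fv i) (v j) = 0.
Proof.
move=> ji; have ij : (i == j) = false by case: eqP ji => // ->; rewrite ltnn.
rewrite (dotvC (fv i)) !dotv_saddle_rhs_v.
rewrite dotv_flip_orthogonal; last first.
  move=> l lj; rewrite vv; case: eqP lj => // <- lj.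
  by have := ltn_trans ji lj; rewrite ltnn.
rewrite dotv_flip_member// (dotvC (v i) x) (dotvC (v j) x) !vx !vv ij (eq_sym j i) ij.
have -> : dotv (v j) (Jmat E x *m v i) = dotv (v i) (Jmat E x *m v j).
  by rewrite dotvC /dotv trmx_mul J_sym mulmxA.
rewrite !mulr0; ring.
Qed.

End Tangency.

Section LocalError.
Variables (R : realType) (d k : nat) (E : 'cV[R]_d -> R).
Hypothesis J_sym : forall x, (Jmat E x)^T = Jmat E x.
Variables (A : 'M[R]_d) (Nf : 'cV[R]_d -> 'cV[R]_d) (L : R).
Hypothesis hA : assumptionA E A Nf L.
Variables (W : Type) (F : set_system W).
Context {FF : Filter F}.
Variable tau : W -> R.
Hypothesis tau_ge0 : \forall w \near F, 0 <= tau w.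
Hypothesis tau_small : forall e, 0 < e -> \forall w \near F, tau w <= e.
Variables (xp xt x : W -> 'cV[R]_d) (vp vt v : 'I_k -> W -> 'cV[R]_d).
Hypothesis prev_admissible :
  \forall w \near F, admissible_data (xp w) (fun i => vp i w).

Let O2 := domV F (fun w => tau w * tau w) (d := d).
Let fx w := saddle_rhs_x E (xp w) (fun j => vp j w).
Let fv i w := saddle_rhs_v E (xp w) (fun j => vp j w) i.

Lemma domV1_unit (u : W -> 'cV[R]_d) :
  (\forall w \near F, l2norm (u w) = 1) -> domV F (fun=> 1) u.
Proof.
move=> h; exists 1; near=> w.
by rewrite (near h w _)// normr1 mulr1.
Unshelve. all: by end_near. Qed.

Let xp1 : \forall w \near F, l2norm (xp w) = 1.
Proof. by apply: filterS prev_admissible => w []. Qed.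

Let vp1 i : \forall w \near F, l2norm (vp i w) = 1.
Proof.
apply: filterS prev_admissible => w [_ /(_ i i) + _].
by rewrite /l2norm eqxx => ->; rewrite sqrtr1.
Qed.

Let bxp : domV F (fun=> 1) xp. Proof. exact: domV1_unit. Qed.
Let bvp i : domV F (fun=> 1) (vp i). Proof. exact: domV1_unit. Qed.

Let bfx : domV F (fun=> 1) fx.
Proof.
have h : congV F (fun=> 1) fx fx; last by case: h.
by apply: (congV_saddle_rhs_x hA) => [|j]; exact: congV_refl.
Qed.

Let bfv i : domV F (fun=> 1) (fv i).
Proof.
have h : congV F (fun=> 1) (fv i) (fv i); last by case: h.
by apply: (congV_saddle_rhs_v (v := vp) (v' := vp) hA) => [|j]; exact: congV_refl.
Qed.

Lemma domV_weight (u y : W -> 'cV[R]_d) : domV F (fun=> 1) u ->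
  domV F (fun w => 1 + l2norm (y w)) u.
Proof.
move=> h; apply: (domV_trans h); exists 1; near=> w.
by rewrite normr1 mul1r lerDl l2norm_ge0.
Unshelve. all: by end_near. Qed.

Lemma domV_weight_self (y : W -> 'cV[R]_d) :
  domV F (fun w => 1 + l2norm (y w)) y.
Proof.
exists 1; near=> w.
by rewrite mul1r ger0_norm ?l2norm_ge0// lerDr.
Unshelve. all: by end_near. Qed.

Lemma domV_mulmx (M : 'M[R]_d) r (y : W -> 'cV[R]_d) : domV F r y ->
  domV F r (fun w => M *m y w).
Proof.
move=> h; have [C _ hC] := mulmx_bounded M.
apply: domV_le (domR1M (domRc C) h); near=> w.
by rewrite (le_trans (hC _))// ler_norm.
Unshelve. all: by end_near. Qed.

Section Position.
Hypothesis position_eq : \forall w \near F, xt w = xp w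
  + tau w *: ((1%:M - 2 *: \sum_(j < k) vp j w *m (vp j w)^T)
                *m (A *m xt w + Nf (xp w)))
  - tau w *: (xp w *m (xp w)^T *m (A *m xp w + Nf (xp w))).
Hypothesis position_normalized : \forall w \near F,
  x w = (l2norm (xt w))^-1 *: xt w.

(** The implicit increment differs from the explicit one by O(tau) because
    [xt - xp] is O(tau); tangency makes the normalization invisible at first
    order. *)
Lemma position_step : O2 (fun w => x w - (xp w + tau w *: fx w)) /\
  \forall w \near F, l2norm (x w) = 1.
Proof.
pose g w := flip (fun j => vp j w) predT (A *m xt w + Nf (xp w))
            - dotv (xp w) (A *m xp w + Nf (xp w)) *: xp w.
have xtE : \forall w \near F, xt w = xp w + tau w *: g w.
  apply: filterS position_eq => w ->.
  by rewrite mul_flip mul_outer -addrA -scalerBr.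
have bN : domV F (fun=> 1) (fun w => Nf (xp w)).
  have [] // := congV_lipschitz (nonlinear_lipschitz hA) (congV_refl (fun=> 1) bxp).
have xt_xp : congV F tau xt xp.
  apply: (implicit_step tau_ge0 tau_small xtE bxp).
  apply: domVD; last first.
    apply/domVN/domV_weight/domVZl => //.
    by apply: domV1_dot => //; apply: domVD => //; exact: domV_mulmx.
  apply: domV_flip => [j _|]; first exact: bvp.
  by apply: domVD; [apply/domV_mulmx/domV_weight_self|exact: domV_weight].
have gf : congV F tau g fx.
  have -> : fx = fun w => flip (fun j => vp j w) predT (A *m xp w + Nf (xp w))
            - dotv (xp w) (A *m xp w + Nf (xp w)) *: xp w.
    by apply/funext => w; rewrite /fx saddle_rhs_xE (force_split hA).
  have bA := congV_lipschitz (linear_lipschitz hA) xt_xp.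
  have bF : congV F tau (fun w => A *m xp w + Nf (xp w))
      (fun w => A *m xp w + Nf (xp w)).
    by apply/congV_refl/domVD; [exact: domV_mulmx|exact: bN].
  apply: congVD.
    apply: congV_flip => [j _|]; first by apply: congV_refl; exact: bvp.
    by apply: congVD; [exact: bA|apply: congV_refl; exact: bN].
  apply/congVN/congVZ; last exact: congV_refl.
  by apply: congR_dot; [exact: congV_refl|exact: bF].
have h : O2 (fun w => xt w - (xp w + tau w *: fx w)).
  exact: first_order_step xtE gf.
have [h1 h2] : O2 (fun w => (l2norm (xt w))^-1 *: xt w - (xp w + tau w *: fx w))
    /\ \forall w \near F, l2norm ((l2norm (xt w))^-1 *: xt w) = 1.
  apply: (normalized_step tau_ge0 tau_small h) => //.
  by apply: filterS prev_admissible => w hw; rewrite /fx dotv_x_rhs_x.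
split.
  apply: domV_near h1; near=> w.
  by rewrite {1}(near position_normalized w _).
near=> w.
rewrite (near position_normalized w _)//; near: w; exact: h2.
Unshelve. all: by end_near. Qed.

End Position.

Section Directions.
Hypothesis x_step : O2 (fun w => x w - (xp w + tau w *: fx w)).
Hypothesis x_unit : \forall w \near F, l2norm (x w) = 1.
Hypothesis direction_eq : forall i, \forall w \near F, vt i w = vp i w
  + tau w *: ((1%:M - x w *m (x w)^T
               - 2 *: \sum_(j < k | (j < i)%N) v j w *m (v j w)^T)
              *m Jmat E (x w) *m vt i w)
  - tau w *: (vp i w *m (vp i w)^T *m Jmat E (x w) *m vp i w)
  + (tau w * dotv (vt i w) (force E (x w))) *: x w.
Let vh i w : 'cV[R]_d := vt i w - dotv (vt i w) (x w) *: x w.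
Let vw (i : 'I_k) w : 'cV[R]_d :=
  vh i w - \sum_(j < k | (j < i)%N) dotv (vh i w) (v j w) *: v j w.
Hypothesis direction_normalized : forall i, \forall w \near F,
  v i w = (l2norm (vw i w))^-1 *: vw i w.

(** The increment of the implicit equation for [vt i]; replacing new values by
    old ones turns it into the saddle field. *)
Let direction_rhs (i : 'I_k) w : 'cV[R]_d :=
  flip (fun j => v j w) (fun j => (j < i)%N) (Jmat E (x w) *m vt i w)
  - dotv (x w) (Jmat E (x w) *m vt i w) *: x w
  - dotv (vp i w) (Jmat E (x w) *m vp i w) *: vp i w
  + dotv (vt i w) (force E (x w)) *: x w.

Let direction_rhsE i : \forall w \near F,
  vt i w = vp i w + tau w *: direction_rhs i w.
Proof.
apply: filterS (direction_eq i) => w {1}->.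
rewrite mul_outer_flip -(mulmxA _ (Jmat E (x w)) (vp i w)) mul_outer.
rewrite -scalerA -(scalerN (tau w)) -(addrA (vp i w)) -(addrA (vp i w)).
by rewrite -!(scalerDr (tau w)).
Qed.

Let bx : domV F (fun=> 1) x. Proof. exact: domV1_unit. Qed.

Let x_xp : congV F tau x xp.
Proof. by have [] := congV_first_order tau_ge0 tau_small bxp bfx x_step. Qed.

(** Consistency and orthonormality are proved together because each direction
    needs both for the directions before it. *)
Definition direction_step_at (i : 'I_k) :=
  O2 (fun w => v i w - (vp i w + tau w *: fv i w)) /\
  \forall w \near F, [/\ l2norm (v i w) = 1, dotv (x w) (v i w) = 0
    & forall j : 'I_k, (j < i)%N -> dotv (v i w) (v j w) = 0].

Section OneDirection.
Variable i : 'I_k.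
Hypothesis ih : forall j : 'I_k, (j < i)%N -> direction_step_at j.

Let v_vp (j : 'I_k) : (j < i)%N -> congV F tau (v j) (vp j).
Proof.
move=> /ih[h _].
by have [] := congV_first_order tau_ge0 tau_small (bvp j) (bfv j) h.
Qed.

Let vt_vp : congV F tau (vt i) (vp i).
Proof.
have F1 : domV F (fun=> 1) (fun w => force E (x w)).
  by have [_ h _] := congV_force hA x_xp.
have hJ : domV F (fun w => 1 + l2norm (vt i w))
    (fun w => Jmat E (x w) *m vt i w).
  by apply: (domV_Jmat hA bx); exact: domV_weight_self.
apply: (implicit_step tau_ge0 tau_small (direction_rhsE i) (bvp i)).
apply: domVD; last first.
  by apply: domVZl bx; apply: domV_dot1 F1; exact: domV_weight_self.
apply: domVD; last first.
  apply/domVN/domV_weight; apply: domVZl (bvp i).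
  by apply: domV1_dot (bvp i) _; exact: (domV_Jmat hA bx (bvp i)).
apply: domVD; last by apply/domVN; apply: domVZl bx; exact: domV1_dot.
by apply: domV_flip hJ => j /v_vp[].
Qed.

Let vt_step : O2 (fun w => vt i w - (vp i w + tau w *: fv i w)).
Proof.
apply: (first_order_step tau_ge0 (direction_rhsE i)).
rewrite (_ : fv i = fun w =>
  flip (fun j => vp j w) (fun j => (j < i)%N) (Jmat E (xp w) *m vp i w)
  - dotv (xp w) (Jmat E (xp w) *m vp i w) *: xp w
  - dotv (vp i w) (Jmat E (xp w) *m vp i w) *: vp i w
  + dotv (vp i w) (force E (xp w)) *: xp w); last first.
  by apply/funext => w; rewrite /fv saddle_rhs_vE.
have hF : congV F tau (fun w => force E (x w)) (fun w => force E (xp w)).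
  exact: (congV_force hA x_xp).
have hJ : congV F tau (fun w => Jmat E (x w) *m vt i w)
    (fun w => Jmat E (xp w) *m vp i w) by exact: (congV_Jmat hA x_xp vt_vp).
have hv : congV F tau (vp i) (vp i) by exact: congV_refl.
have hJv : congV F tau (fun w => Jmat E (x w) *m vp i w)
    (fun w => Jmat E (xp w) *m vp i w) by exact: (congV_Jmat hA x_xp hv).
apply: congVD; last by apply: congVZ x_xp; exact: congR_dot vt_vp hF.
apply: congVD; last by apply: congVN; apply: (congVZ _ hv); exact: congR_dot hv hJv.
apply: congVD; last first.
  by apply: congVN; apply: congVZ x_xp; exact: congR_dot x_xp hJ.
by apply: congV_flip hJ => j /v_vp.
Qed.

Let vw_step : O2 (fun w => vw i w - (vp i w + tau w *: fv i w)).
Proof.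
have vtx : domR F (fun w => tau w * tau w) (fun w => dotv (vt i w) (x w) - 0).
  apply: (first_order_dot tau_ge0 tau_small (bvp i) bxp (bfv i) bfx
    vt_step x_step).
    by apply: filterS prev_admissible => w [_ _ h]; rewrite dotvC.
  by apply: filterS prev_admissible => w hw; exact: dotv_v_rhs_x.
have vh_step : O2 (fun w => vh i w - (vp i w + tau w *: fv i w)).
  apply: (domV_near _ (domVD vt_step (domVN (domVZl vtx bx)))); near=> w.
  by rewrite subr0 addrAC.
have vhv (j : 'I_k) : (j < i)%N ->
    domR F (fun w => tau w * tau w) (fun w => dotv (vh i w) (v j w) - 0).
  move=> ji; have [vj _] := ih ji.
  apply: (first_order_dot tau_ge0 tau_small (bvp i) (bvp j) (bfv i) (bfv j)
    vh_step vj).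
    apply: filterS prev_admissible => w [_ -> _].
    by case: eqP ji => // ->; rewrite ltnn.
  by apply: filterS prev_admissible => w hw; exact: dotv_v_rhs_v_lt.
have hs : O2 (fun w => \sum_(j < k | (j < i)%N) (dotv (vh i w) (v j w) - 0) *: v j w).
  by apply: domV_sum => j ji; apply: domVZl (vhv j ji) _; have [] := v_vp ji.
apply: (domV_near _ (domVD vh_step (domVN hs))); near=> w.
by under [X in _ = _ - X]eq_bigr do rewrite subr0; rewrite addrAC.
Unshelve. all: by end_near. Qed.

(** The components of [vt i] removed by the projection and by the Gram-Schmidt
    sum are inner products of vectors expanded to first order, hence O(tau^2)
    by tangency. *)
Lemma direction_step : direction_step_at i.
Proof.
have [h1 h2] : O2 (fun w => (l2norm (vw i w))^-1 *: vw i w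
      - (vp i w + tau w *: fv i w))
    /\ \forall w \near F, l2norm ((l2norm (vw i w))^-1 *: vw i w) = 1.
  apply: (normalized_step tau_ge0 tau_small vw_step) => //.
  by apply: filterS prev_admissible => w hw; exact: dotv_v_rhs_v.
split.
  apply: domV_near h1; apply: filterS (direction_normalized i) => w {1}->//.
have ih' : \forall w \near F, forall j : 'I_k, (j < i)%N ->
    [/\ l2norm (v j w) = 1, dotv (x w) (v j w) = 0
    & forall l : 'I_k, (l < j)%N -> dotv (v j w) (v l w) = 0].
  apply: filter_forall => j; case: (boolP (j < i)%N) => [/ih[_]|_].
    by apply: filterS.
  by apply: nearW.
near=> w.
have vE : v i w = (l2norm (vw i w))^-1 *: vw i w.
  by near: w; exact: direction_normalized.
have x1 : dotv (x w) (x w) = 1.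
  by rewrite -sqr_l2norm (near x_unit w _)// expr1n.
have hj : forall j : 'I_k, (j < i)%N ->
    [/\ l2norm (v j w) = 1, dotv (x w) (v j w) = 0
    & forall l : 'I_k, (l < j)%N -> dotv (v j w) (v l w) = 0] by near: w.
split.
- by rewrite vE; near: w.
- rewrite vE; move: (_^-1) => c; rewrite dotvZr /vw dotvDr dotvNr dotv_sumr big1 => [|j /hj[_ xv _]].
    by rewrite subr0 /vh dotvDr dotvNr dotvZr x1 mulr1 (dotvC (x w)) subrr mulr0.
  by rewrite dotvZr xv mulr0.
- move=> j ji; rewrite vE; move: (_^-1) => c; rewrite dotvZl /vw dotvDl dotvNl dotv_suml (bigD1 j)//=.
  have [vj _ vjl] := hj j ji.
  rewrite dotvZl -[dotv (v j w) _]sqr_l2norm vj expr1n mulr1 big1.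
    by rewrite addr0 subrr mulr0.
  move=> l /andP[li lj]; rewrite dotvZl.
  have [_ _ vlj] := hj l li.
  case: (ltngtP l j) => [lltj|jltl|/ord_inj lej].
  + by rewrite (dotvC (v l w)) vjl// mulr0.
  + by rewrite vlj// mulr0.
  + by rewrite lej eqxx in lj.
Unshelve. all: by end_near. Qed.

End OneDirection.

Lemma directions_step i : direction_step_at i.
Proof.
have [n] := ubnP (nat_of_ord i); elim: n i => // n IHn i; rewrite ltnS => le_in.
by apply: direction_step => j ji; apply: IHn; exact: leq_trans ji le_in.
Qed.

Lemma next_admissible :
  \forall w \near F, admissible_data (x w) (fun i => v i w).
Proof.
have h : \forall w \near F, forall i : 'I_k,
    [/\ l2norm (v i w) = 1, dotv (x w) (v i w) = 0
    & forall j : 'I_k, (j < i)%N -> dotv (v i w) (v j w) = 0].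
  by apply: filter_forall => i; have [] := directions_step i.
near=> w.
have hw : forall i : 'I_k, [/\ l2norm (v i w) = 1, dotv (x w) (v i w) = 0
    & forall j : 'I_k, (j < i)%N -> dotv (v i w) (v j w) = 0] by near: w.
split; first by near: w.
  move=> i j; case: (ltngtP i j) => [ij|ji|/ord_inj ->].
  - have [_ _ /(_ _ ij)] := hw j; rewrite dotvC => ->.
    by case: eqP ij => // ->; rewrite ltnn.
  - have [_ _ /(_ _ ji) ->] := hw i.
    by case: eqP ji => // ->; rewrite ltnn.
  - by have [vj _ _] := hw j; rewrite -sqr_l2norm vj expr1n eqxx.
by move=> i; have [] := hw i.
Unshelve. all: by end_near. Qed.

End Directions.

End LocalError.

(** * One-step methods for ordinary differential equations *)

Section VectorCalculus.
Variables (R : realType) (d : nat).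
Implicit Types (u : 'cV[R]_d) (x : R -> 'cV[R]_d).

Lemma continuous_coord (i : 'I_d) : continuous (fun u : 'cV[R]_d => u i 0).
Proof. exact: coord_continuous. Qed.

Lemma continuous_dotv u : continuous (dotv u).
Proof.
rewrite (_ : dotv u = fun w => \sum_i u i 0 * w i 0); last first.
  by apply/funext => w; exact: dotvE.
apply: continuous_big => [|i _ w]; first exact: add_continuous.
have h : (fun w : 'cV[R]_d => w i 0) @ w --> w i 0 by exact: continuous_coord.
exact: (cvgM (cvg_cst (u i 0)) h).
Qed.

Lemma continuous_l2norm : continuous (@l2norm R d).
Proof.
rewrite (_ : @l2norm R d =
  Num.sqrt \o (fun w : 'cV[R]_d => \sum_i w i 0 * w i 0)); last first.
  by apply/funext => w; rewrite /l2norm dotvE.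
move=> u; apply: continuous_comp; last exact: sqrt_continuous.
move: u; apply: continuous_big => [|i _ w]; first exact: add_continuous.
have h : (fun w : 'cV[R]_d => w i 0) @ w --> w i 0 by exact: continuous_coord.
exact: (cvgM h h).
Qed.

Lemma within_continuous_distance x u (D : set R) :
  {within D, continuous x} -> {within D, continuous (fun t => l2norm (x t - u))}.
Proof.
move=> xc; have hc : continuous (fun w : 'cV[R]_d => l2norm (w - u)).
  rewrite (_ : (fun _ => _) = @l2norm R d \o (fun w : 'cV[R]_d => w - u))//.
  move=> w; apply: continuous_comp; last exact: continuous_l2norm.
  have h1 : (fun v : 'cV[R]_d => v) @ w --> w by exact: cvg_id.
  have h2 : (fun _ : 'cV[R]_d => u) @ w --> u.
    by apply: (@cvg_cst _ _ _ (nbhs w)).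
  exact: (cvgB h1 h2).
by move=> t; exact: (continuous_comp (xc t) (hc (x t))).
Qed.

Lemma is_derive_dotv u x (t : R) dx : is_derive t 1 x dx ->
  is_derive t 1 (fun s => dotv u (x s)) (dotv u dx).
Proof.
move=> [x_drv x_val].
have coord i : is_derive t 1 (fun s => x s i 0) (dx i 0).
  apply: DeriveDef; first exact: (derivable_mxP x t 1).1.
  by rewrite -x_val derive_mx// mxE.
rewrite (_ : (fun s => _) = \sum_i (u i 0 \*: (fun s => x s i 0))).
  by rewrite dotvE; apply: is_derive_sum => i; exact: is_deriveZ.
by apply/funext => s; rewrite dotvE fct_sumE.
Qed.

(** No vector-valued mean value theorem holds with equality; pairing with the
    increment itself reduces the inequality to the scalar theorem. *)
Lemma l2norm_increment_le x dx (a b K : R) c : a < b ->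
  {within `[a, b], continuous x} ->
  (forall t, a < t < b -> is_derive t 1 x (dx t)) ->
  (forall t, a < t < b -> l2norm (dx t - c) <= K) ->
  l2norm (x b - x a - (b - a) *: c) <= K * (b - a).
Proof.
move=> ab xc xdx dxK; set u := x b - x a - _.
have [s sab hs] : exists2 s, s \in `]a, b[
    & dotv u (x b) - dotv u (x a) = dotv u (dx s) * (b - a).
  apply: (@MVT _ (fun s => dotv u (x s)) (fun s => dotv u (dx s))) => //.
    by move=> s; rewrite in_itv/= => /xdx; exact: is_derive_dotv.
  by move=> s; apply: continuous_comp; [exact: xc|exact: continuous_dotv].
rewrite in_itv/= in sab.
have K0 : 0 <= K := le_trans (l2norm_ge0 _) (dxK s sab).
have uu : dotv u u = dotv u (dx s - c) * (b - a).
  by rewrite {2}/u !dotvDr !dotvNr dotvZr hs; ring.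
have [u0|un0] := eqVneq (l2norm u) 0.
  by rewrite u0 mulr_ge0// subr_ge0 ltW.
have u_gt0 : 0 < l2norm u by rewrite lt_neqAle eq_sym un0 l2norm_ge0.
rewrite -(ler_pM2l u_gt0) -expr2 sqr_l2norm uu mulrA.
apply: ler_wpM2r; first by rewrite subr_ge0 ltW.
rewrite (le_trans (ler_norm _))// (le_trans (cauchy_schwarz _ _))//.
by rewrite ler_wpM2l ?l2norm_ge0 ?dxK.
Qed.

End VectorCalculus.

(** Continuity induction: the first point of [a, b] where [f] reaches [r] would
    contradict the hypothesis. *)
Lemma continuous_stays_below (R : realType) (f : R -> R) (a b r : R) :
  {within `[a, b], continuous f} ->
  (forall c, a <= c <= b -> (forall t, a <= t < c -> f t < r) -> f c < r) ->
  forall t, a <= t <= b -> f t < r.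
Proof.
move=> fc step t1 t1ab; rewrite ltNge; apply/negP => ft1.
pose S := [set t | a <= t <= b /\ r <= f t].
have S1 : S t1 by [].
have Slb : has_lbound S by exists a => s [/andP[]].
have infS : has_inf S by split => //; exists t1.
have t1_ge := ge_inf Slb S1.
have cab : a <= inf S <= b.
  apply/andP; split; first by apply: lb_le_inf; [exists t1|move=> s [/andP[]]].
  by case/andP: t1ab => _; exact: le_trans.
have fltr : f (inf S) < r.
  apply: step => // t /andP[at_ tS]; rewrite ltNge; apply/negP => ft.
  suff St : S t by have := ge_inf Slb St; rewrite leNgt tS.
  split => //; rewrite at_/=; case/andP: cab => _; exact/le_trans/ltW.
move: fc => /subspace_continuousP /(_ (inf S)).
rewrite /= in_itv/= => /(_ cab) /cvgr_lt /(_ _ fltr).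
move=> /nbhs_ballP[e /= e0 he].
have [s Ss sS] := inf_adherent e0 infS.
have [sab fs] := Ss; have sge := ge_inf Slb Ss.
suff : f s < r by rewrite ltNge fs.
apply: he; last by rewrite /= in_itv.
by rewrite /ball/= distrC ger0_norm ?subr_ge0// ltrBlDl.
Qed.

Section OneStepMethod.
Variables (R : realType) (d : nat) (I : finType).
Variable f : (I -> 'cV[R]_d) -> I -> 'cV[R]_d.
Variables M K : R.
Hypothesis M_ge0 : 0 <= M.
Hypothesis K_gt0 : 0 < K.

(** The radius 2 leaves room around the unit vectors that the scheme
    produces. *)
Definition in_ball (z : I -> 'cV[R]_d) := forall i, l2norm (z i) <= 2.

Hypothesis f_bounded : forall z, in_ball z -> forall i, l2norm (f z i) <= M.
Hypothesis f_lipschitz : forall z z' e, in_ball z -> in_ball z' ->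
  (forall i, l2norm (z i - z' i) <= e) ->
  forall i, l2norm (f z i - f z' i) <= K * e.

Definition solves (z : I -> R -> 'cV[R]_d) (a b : R) :=
  (forall i, {within `[a, b], continuous (z i)}) /\
  forall i t, a < t < b -> is_derive t 1 (z i) (f (fun j => z j t) i).

Lemma solves_sub z a b a' b' : a <= a' -> b' <= b ->
  solves z a b -> solves z a' b'.
Proof.
move=> aa' b'b [zc zd]; split => [i|i t /andP[at_ tb]].
  apply: continuous_subspaceW (zc i) => t /=; rewrite !in_itv/= => /andP[at_ tb].
  by rewrite (le_trans aa')// (le_trans tb).
by apply: zd; rewrite (le_lt_trans aa')// (lt_le_trans tb).
Qed.

Lemma increment_le z a b : a < b -> solves z a b ->
  (forall t, a < t < b -> in_ball (fun j => z j t)) ->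
  forall i, l2norm (z i b - z i a) <= M * (b - a).
Proof.
move=> ab [zc zd] zb i; rewrite -[X in l2norm X]subr0 -(scaler0 _ (b - a)).
apply: l2norm_increment_le (zc i) (zd i) _ => // t tab.
by rewrite subr0; exact/f_bounded/zb.
Qed.

(** Over a short time a solution cannot travel the distance 1/2 from the ball of
    radius 3/2 to the boundary of the ball on which its speed is bounded. *)
Lemma solution_confined z a b : solves z a b ->
  (forall i, l2norm (z i a) <= 3 / 2) -> #|I|%:R * M * (b - a) < 2^-1 ->
  forall t, a <= t <= b -> in_ball (fun j => z j t).
Proof.
move=> zs za small.
pose g t := \sum_i l2norm (z i t - z i a).
have g_ge i t : l2norm (z i t - z i a) <= g t.
  rewrite /g (bigD1 i)//= lerDl sumr_ge0// => j _; exact: l2norm_ge0.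
have ball_of t : g t < 2^-1 -> in_ball (fun j => z j t).
  move=> gt i; rewrite -(subrK (z i a) (z i t)) (le_trans (l2normD _ _))//.
  have := g_ge i t; have := za i; lra.
suff gsmall : forall t, a <= t <= b -> g t < 2^-1 by move=> t /gsmall/ball_of.
apply: continuous_stays_below.
  rewrite /g; apply: continuous_big => [|i _]; first exact: add_continuous.
  exact: within_continuous_distance (zs.1 i).
move=> c /andP[ac cb] gc.
have gle : g c <= #|I|%:R * M * (c - a).
  rewrite -mulrA mulr_natl -sumr_const ler_sum// => i _.
  move: ac; rewrite le_eqVlt => /predU1P[<-|ac].
    by rewrite !subrr l2norm0 mulr0.
  apply: increment_le => //; first exact: solves_sub zs.
  by move=> t /andP[at_ tc]; apply/ball_of/gc; rewrite (ltW at_).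
apply: le_lt_trans gle (le_lt_trans _ small).
by rewrite ler_wpM2l ?mulr_ge0// lerD2r.
Qed.

(** The explicit Euler step has a quadratic defect along an exact solution that
    starts well inside the ball. *)
Lemma exact_step z a b : a < b -> solves z a b ->
  (forall i, l2norm (z i a) <= 3 / 2) -> #|I|%:R * M * (b - a) < 2^-1 ->
  forall i, l2norm (z i b - z i a - (b - a) *: f (fun j => z j a) i)
    <= K * (M * (b - a)) * (b - a).
Proof.
move=> ab zs za small i; have zb := solution_confined zs za small.
apply: l2norm_increment_le (zs.1 i) (zs.2 i) _ => // t tab.
have /andP[at_ tb] := tab.
apply: f_lipschitz => [||j].
- by apply: zb; rewrite !ltW.
- by apply: zb; rewrite lexx ltW.
apply: le_trans (increment_le at_ _ _ j) _.
- by apply: solves_sub zs => //; exact: ltW.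
- move=> s /andP[as_ st]; apply: zb; rewrite ltW//=.
  by rewrite (ltW (lt_trans st tb)).
- by rewrite ler_wpM2l// lerD2r ltW.
Qed.

(** The numerical solution is bounded, and the error estimate, as it propagates,
    keeps the exact one in the ball on which [f] is controlled. *)
Lemma one_step_convergence (T C : R) : 0 < T -> 0 <= C ->
  exists tau0 Q, [/\ 0 < tau0, 0 < Q &
    forall z (N : nat) (y : nat -> I -> 'cV[R]_d), (0 < N)%N ->
    let tau := T / N%:R in tau <= tau0 -> solves z 0 T ->
    (forall i, z i 0 = y 0%N i) ->
    (forall n i, (n <= N)%N -> l2norm (y n i) <= 1) ->
    (forall n i, (n < N)%N ->
      l2norm (y n.+1 i - (y n i + tau *: f (y n) i)) <= C * (tau * tau)) ->
    forall n i, (n <= N)%N -> l2norm (z i (n%:R * tau) - y n i) <= Q * tau].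
Proof.
move=> T0 C0.
(* The defects of the scheme and of the exact solution add up to at most
   (C + K M) tau^2 per step; the extra 1 makes B positive. *)
pose B := (C + K * M + 1) / K.
have B0 : 0 < B by rewrite divr_gt0// ltr_wpDl// addr_ge0// mulr_ge0// ltW.
have BK : B * K = C + K * M + 1 by rewrite /B divfK// gt_eqF.
pose Q := B * expR (K * T).
have Q0 : 0 < Q by rewrite mulr_gt0// expR_gt0.
pose P := #|I|%:R * M + 1.
have P0 : 0 < P by rewrite ltr_wpDl// mulr_ge0.
(* The first bound confines the exact solution during one step, the second
   keeps the accumulated error below 1/2. *)
exists (Num.min (4^-1 / P) (2^-1 / Q)), Q; split => //.
  by rewrite lt_min !divr_gt0.
move=> z N y N0 tau; rewrite le_min !ler_pdivlMr// => /andP[tauP tauQ].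
move=> zs z0 y1 ystep.
have NR : 0 < N%:R :> R by rewrite ltr0n.
have tau0 : 0 < tau by rewrite divr_gt0.
have NT : N%:R * tau = T by rewrite /tau mulrC divfK// gt_eqF.
have key n : (n <= N)%N -> forall i,
    l2norm (z i (n%:R * tau) - y n i) <= B * tau * (expR (K * (n%:R * tau)) - 1).
  elim: n => [_ i|n IHn nN i].
    by rewrite mul0r z0 subrr l2norm0 mulr0 expR0 subrr mulr0.
  have {}IHn := IHn (ltnW nN).
  set a := n%:R * tau; set b := n.+1%:R * tau.
  have ba : b - a = tau by rewrite /a /b -mulrBl -natrB// subSnn mul1r.
  have ab : a < b by rewrite -subr_gt0 ba.
  have a0 : 0 <= a by rewrite mulr_ge0// ltW.
  have bT : b <= T by rewrite -NT ler_pM2r// ler_nat.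
  set e := B * tau * (expR (K * a) - 1).
  have e_le : e <= 2^-1.
    rewrite (le_trans _ tauQ)// /e /Q -mulrA (mulrCA B) ler_pM2l//.
    rewrite ler_pM2l// (@le_trans _ _ (expR (K * a)))//; first by rewrite gerBl.
    by rewrite ler_expR ler_pM2l// (le_trans (ltW ab)).
  have za j : l2norm (z j a) <= 3 / 2.
    rewrite -(subrK (y n j) (z j a)) (le_trans (l2normD _ _))//.
    have := IHn j; have := y1 n j (ltnW nN); rewrite -/a -/e; lra.
  have zab : solves z a b by exact: solves_sub zs.
  have small : #|I|%:R * M * (b - a) < 2^-1.
    rewrite ba; move: tauP; rewrite /P; move: (#|I|%:R * M) => c; lra.
  have h1 := exact_step ab zab za small i.
  have h2 := ystep n i nN.
  have h3 : l2norm (f (fun j => z j a) i - f (y n) i) <= K * e.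
    apply: f_lipschitz => [j|j|j]; last exact: IHn.
      by apply: le_trans (za j) _; lra.
    by apply: le_trans (y1 n j (ltnW nN)) _; lra.
  rewrite ba in h1.
  (* Exact defect, propagated error, Lipschitz term, defect of the scheme. *)
  have -> : z i b - y n.+1 i =
      (z i b - z i a - tau *: f (fun j => z j a) i)
    + (z i a - y n i) + tau *: (f (fun j => z j a) i - f (y n) i)
    - (y n.+1 i - (y n i + tau *: f (y n) i)).
    by apply/matrixP => p q; rewrite !mxE; ring.
  apply: (@le_trans _ _ (K * (M * tau) * tau + e + tau * (K * e) + C * (tau * tau))).
    rewrite (le_trans (l2normD _ _))// l2normN lerD//.
    rewrite (le_trans (l2normD _ _))// lerD//.
      by rewrite (le_trans (l2normD _ _))// lerD//; exact: IHn.
    by rewrite l2normZ gtr0_norm// ler_pM2l.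
  have -> : K * b = K * a + K * tau by rewrite -ba; ring.
  rewrite expRD.
  have hexp : 1 + K * tau <= expR (K * tau) by exact: expR_ge1Dx.
  have hexp0 : 0 < expR (K * a) by exact: expR_gt0.
  rewrite /e; move: (expR (K * a)) (expR (K * tau)) hexp hexp0 => E F hexp hexp0.
  have : B * tau * (E * (1 + K * tau)) <= B * tau * (E * F).
    by rewrite !ler_pM2l// mulr_gt0.
  have : B * K * (tau * tau) = (C + K * M + 1) * (tau * tau) by rewrite BK.
  have : 0 < tau * tau by rewrite mulr_gt0.
  nra.
move=> n i nN; rewrite (le_trans (key n nN i))// /Q [leRHS]mulrAC.
rewrite ler_pM2l; last by apply: mulr_gt0.
rewrite (@le_trans _ _ (expR (K * (n%:R * tau))))//; first by rewrite gerBl.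
by rewrite ler_expR ler_pM2l// -NT ler_pM2r// ler_nat.
Qed.

End OneStepMethod.

(** * Uniform constants *)

Lemma domV_uniform (R : realType) (W : Type) (F : set_system W)
    (FF : Filter F) (d : nat) (I : finType) r (u : I -> W -> 'cV[R]_d) :
  (forall i, domV F r (u i)) ->
  exists2 C, 0 < C & \forall w \near F, forall i, l2norm (u i w) <= C * `|r w|.
Proof.
move=> /(_ _)/domR_ge0/cid2-h; pose C i := sval (h i).
have C0 i : 0 <= C i by rewrite /C; case: (h i).
exists (\sum_i C i + 1); first by rewrite ltr_wpDl// sumr_ge0.
apply: filter_forall => i; have hi : \forall w \near F,
  `|l2norm (u i w)| <= C i * `|r w| by rewrite /C; case: (h i).
apply: filterS hi => w; rewrite ger0_norm ?l2norm_ge0// => /le_trans; apply.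
rewrite ler_wpM2r// (bigD1 i)//= -addrA lerDl addr_ge0// sumr_ge0//.
Qed.

Section SaddleState.
Variables (R : realType) (d k : nat) (E : 'cV[R]_d -> R).

(** With one index type for the position and the directions, a single bound
    controls all components of the system. *)
Definition state (x : 'cV[R]_d) (v : 'I_k -> 'cV[R]_d) (o : option 'I_k) :=
  if o is Some i then v i else x.

Definition saddle_field (z : option 'I_k -> 'cV[R]_d) : option 'I_k -> 'cV[R]_d :=
  state (saddle_rhs_x E (z None) (fun j => z (Some j)))
        (saddle_rhs_v E (z None) (fun j => z (Some j))).

Variables (A : 'M[R]_d) (Nf : 'cV[R]_d -> 'cV[R]_d) (L : R).
Hypothesis hA : assumptionA E A Nf L.

Lemma congV_saddle_field (W : Type) (F : set_system W) (FF : Filter F) r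
    (z z' : option 'I_k -> W -> 'cV[R]_d) :
  (forall o, congV F r (z o) (z' o)) ->
  forall o, congV F r (fun w => saddle_field (fun o => z o w) o)
                      (fun w => saddle_field (fun o => z' o w) o).
Proof.
move=> h [i|] /=.
  exact: (congV_saddle_rhs_v (v := fun j => z (Some j))
    (v' := fun j => z' (Some j)) hA i (h None) (fun j => h (Some j))).
exact: (congV_saddle_rhs_x (v := fun j => z (Some j))
  (v' := fun j => z' (Some j)) hA (h None) (fun j => h (Some j))).
Qed.

Lemma saddle_field_bounded : exists2 M, 0 < M &
  forall z, in_ball z -> forall o, l2norm (saddle_field z o) <= M.
Proof.
pose F := globally [set z : option 'I_k -> 'cV[R]_d | in_ball z].
have FF : Filter F by exact: globally_filter.
have hz o : congV F (fun=> 1) (fun z => z o) (fun z => z o).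
  apply: congV_refl; exists 2 => z /= zb.
  by rewrite mulr1 ger0_norm ?l2norm_ge0 ?zb.
have hf o : domV F (fun=> 1) (fun z => saddle_field z o).
  by have [_ h _] := congV_saddle_field FF hz o.
have [M M0 hM] := domV_uniform FF hf.
by exists M => // z zb o; have := hM z zb o; rewrite normr1 mulr1.
Qed.

(** The weight is the distance bound [e] itself, carried along with the two
    states. *)
Lemma saddle_field_lipschitz : exists2 K, 0 < K & forall z z' e,
  in_ball z -> in_ball z' -> (forall o, l2norm (z o - z' o) <= e) ->
  forall o, l2norm (saddle_field z o - saddle_field z' o) <= K * e.
Proof.
pose S := option 'I_k -> 'cV[R]_d.
pose F := globally [set w : S * S * R | [/\ in_ball w.1.1, in_ball w.1.2
  & forall o, l2norm (w.1.1 o - w.1.2 o) <= w.2]].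
have FF : Filter F by exact: globally_filter.
have hz o : congV F (fun w => w.2) (fun w => w.1.1 o) (fun w => w.1.2 o).
  split; [exists 1|exists 2|exists 2] => -[[z z'] e] /= [zb z'b ze].
  - by rewrite mul1r ger0_norm ?l2norm_ge0.
  - by rewrite mulr1 ger0_norm ?l2norm_ge0 ?zb.
  - by rewrite mulr1 ger0_norm ?l2norm_ge0 ?z'b.
have hf o : domV F (fun w => w.2)
    (fun w => saddle_field w.1.1 o - saddle_field w.1.2 o).
  by have [h _ _] := congV_saddle_field FF hz o.
have [K K0 hK] := domV_uniform FF hf.
exists K => // z z' e zb z'b ze o.
have := hK (z, z', e) (And3 zb z'b ze) o => /=.
by rewrite [`|e|]ger0_norm// (le_trans _ (ze None))// l2norm_ge0.
Qed.

Hypothesis J_sym : forall x, (Jmat E x)^T = Jmat E x.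

(** The intermediate vectors are recorded because the estimates are about
    functions of the whole step. *)
Record step_data := StepData {
  step_size : R;
  old_x : 'cV[R]_d; old_v : 'I_k -> 'cV[R]_d;
  raw_x : 'cV[R]_d; raw_v : 'I_k -> 'cV[R]_d;
  new_x : 'cV[R]_d; new_v : 'I_k -> 'cV[R]_d }.

Definition legal_step (w : step_data) :=
  [/\ 0 <= step_size w, admissible_data (old_x w) (old_v w),
      [/\ raw_x w = old_x w
        + step_size w *: ((1%:M - 2 *: \sum_(j < k) old_v w j *m (old_v w j)^T)
                    *m (A *m raw_x w + Nf (old_x w)))
        - step_size w *: (old_x w *m (old_x w)^T
                    *m (A *m old_x w + Nf (old_x w))) &
      new_x w = (l2norm (raw_x w))^-1 *: raw_x w],
      forall i, raw_v w i = old_v w i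
        + step_size w *: ((1%:M - new_x w *m (new_x w)^T
             - 2 *: \sum_(j < k | (j < i)%N) new_v w j *m (new_v w j)^T)
                    *m Jmat E (new_x w) *m raw_v w i)
        - step_size w *: (old_v w i *m (old_v w i)^T
                    *m Jmat E (new_x w) *m old_v w i)
        + (step_size w * dotv (raw_v w i) (force E (new_x w))) *: new_x w
    & forall i,
        let vh := raw_v w i - dotv (raw_v w i) (new_x w) *: new_x w in
        let y := vh - \sum_(j < k | (j < i)%N)
          dotv vh (new_v w j) *: new_v w j in
        new_v w i = (l2norm y)^-1 *: y].

(** Filtering the set of all steps, from all starting points, makes O(tau^2)
    uniform in the starting point. *)
Definition small_steps : set_system step_data :=
  filter_from [set e : R | 0 < e]
    (fun e => [set w | legal_step w /\ step_size w <= e]).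

Lemma small_steps_filter : Filter small_steps.
Proof.
apply: filter_from_filter; first by exists 1 => /=.
move=> e e' /= e0 e'0; exists (Num.min e e'); first by rewrite /= lt_min e0.
by move=> w [lw]; rewrite le_min => /andP[].
Qed.

Lemma local_error : exists delta C, [/\ 0 < delta, 0 < C &
  forall tau xp vp x v, 0 <= tau <= delta -> admissible_data xp vp ->
  semi_implicit_step E A Nf tau xp vp x v ->
  admissible_data x v /\ forall o,
    l2norm (state x v o - (state xp vp o
                           + tau *: saddle_field (state xp vp) o))
    <= C * (tau * tau)].
Proof.
have FF := small_steps_filter.
have legal : \forall w \near small_steps, legal_step w.
  by exists 1 => //= w [].
have eventually (P : step_data -> Prop) : (forall w, legal_step w -> P w) ->
    \forall w \near small_steps, P w.
  by move=> h; apply: filterS legal.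
have tau0 : \forall w \near small_steps, 0 <= step_size w.
  by apply: eventually => w [].
have tau_small e : 0 < e -> \forall w \near small_steps, step_size w <= e.
  by move=> e0; exists e => // w [].
have adm : \forall w \near small_steps, admissible_data (old_x w) (old_v w).
  by apply: eventually => w [].
have [hx x1] := position_step hA tau0 tau_small
  (xp := old_x) (vp := fun i w => old_v w i) (xt := raw_x) (x := new_x) adm
  (eventually _ (fun w '(And5 _ _ (conj e _) _ _) => e))
  (eventually _ (fun w '(And5 _ _ (conj _ e) _ _) => e)).
have dir_eq i := eventually _ (fun w '(And5 _ _ _ e _) => e i).
have dir_nm i := eventually _ (fun w '(And5 _ _ _ _ e) => e i).
have hv := directions_step J_sym hA (FF := FF) tau0 tau_small adm hx x1
  (vt := fun i w => raw_v w i) (v := fun i w => new_v w i) dir_eq dir_nm.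
have hadm := next_admissible J_sym hA (FF := FF) tau0 tau_small adm hx x1
  (vt := fun i w => raw_v w i) (v := fun i w => new_v w i) dir_eq dir_nm.
have hst o : domV small_steps (fun w => step_size w * step_size w)
    (fun w => state (new_x w) (new_v w) o - (state (old_x w) (old_v w) o
       + step_size w *: saddle_field (state (old_x w) (old_v w)) o)).
  by case: o => [i|] /=; [have [] := hv i|exact: hx].
have [C C0 hC] := domV_uniform FF hst.
have [delta /= delta0 hdelta] := filterI hadm hC.
exists delta, C; split => // tau xp vp x v /andP[tau_ge0 tau_le] hadm_p.
move=> [xt [vt [e1 e2 e3 e4]]].
have [h1 h2] := hdelta (StepData tau xp vp xt vt x v)
  (conj (And5 tau_ge0 hadm_p (conj e1 e2) e3 e4) tau_le).
split; first exact: h1.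
by move=> o; have := h2 o; rewrite /= [`|tau * tau|]ger0_norm ?mulr_ge0.
Qed.

End SaddleState.

(** * Convergence *)

Lemma state_unit (R : realType) (d k : nat) (x : 'cV[R]_d)
    (v : 'I_k -> 'cV[R]_d) :
  admissible_data x v -> forall o, l2norm (state x v o) = 1.
Proof.
move=> [x1 vv _] [i|] //=.
by rewrite /l2norm vv eqxx sqrtr1.
Qed.

Unset Implicit Arguments.

Theorem theorem4p2 (R : realType) (d k : nat) (k_ge1 : (1 <= k)%N)
  (T : R) (T_gt0 : 0 < T)
  (E : 'cV[R]_d -> R) (E_diff2 : twice_differentiable E)
  (J_sym : forall x, (Jmat E x)^T = Jmat E x)
  (A : 'M[R]_d) (Nf : 'cV[R]_d -> 'cV[R]_d) (L : R) (L_gt0 : 0 < L)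
  (hA : assumptionA E A Nf L)
  (x0 : 'cV[R]_d) (v0 : 'I_k -> 'cV[R]_d) (h0 : admissible_data x0 v0) :
  exists tau0 Q : R, 0 < tau0 /\ 0 < Q /\
    forall (x : R -> 'cV[R]_d) (v : 'I_k -> R -> 'cV[R]_d),
      saddle_dynamics_solution E T x0 v0 x v ->
    forall N : nat, (1 <= N)%N ->
    let tau := T / N%:R in
    tau <= tau0 ->
    forall (xn : nat -> 'cV[R]_d) (vn : 'I_k -> nat -> 'cV[R]_d),
      numerical_solution E A Nf tau N x0 v0 xn vn ->
    \big[Num.max/0]_(1 <= n < N.+1)
      Num.max (l2norm (x (n%:R * tau) - xn n))
        (\big[Num.max/0]_(i < k) l2norm (v i (n%:R * tau) - vn i n))
    <= Q * tau.
Proof.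
have [M M_gt0 field_bounded] := @saddle_field_bounded R d k E A Nf L hA.
have [K K_gt0 field_lipschitz] := @saddle_field_lipschitz R d k E A Nf L hA.
have [delta [C [delta_gt0 C_gt0 local]]] := @local_error R d k E A Nf L hA J_sym.
have [tau1 [Q [tau1_gt0 Q_gt0 converges]]] :=
  one_step_convergence (ltW M_gt0) K_gt0 field_bounded field_lipschitz
    T_gt0 (ltW C_gt0).
exists (Num.min delta tau1), Q; split; first by rewrite lt_min delta_gt0.
split => // x v [[x_init v_init] [x_cont v_cont] x_eq v_eq] N N_ge1 tau.
rewrite le_min => /andP[tau_delta tau_tau1] xn vn [xn0 vn0 step].
have tau_ge0 : 0 <= tau by rewrite divr_ge0 // ltW.
have adm n : (n <= N)%N -> admissible_data (xn n) (fun i => vn i n).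
  elim: n => [_|n IHn nN].
    by rewrite xn0 (_ : (fun i => _) = v0)//; apply/funext.
  have [] // := local tau _ _ _ _ _ (IHn (ltnW nN)) (step n.+1 nN).
  by rewrite tau_ge0.
have err n : (n <= N)%N -> forall o,
    l2norm (state (x (n%:R * tau)) (fun i => v i (n%:R * tau)) o
            - state (xn n) (fun i => vn i n) o) <= Q * tau.
  move=> nN o.
  apply: (converges (fun o t => state (x t) (fun i => v i t) o) N
    (fun n => state (xn n) (fun i => vn i n))) => //.
  - by split => [[i|]|[i|] t t0T] /=; [exact: v_cont|exact: x_cont
      |exact: v_eq|exact: x_eq].
  - by case=> [i|] /=; rewrite ?v_init ?x_init ?vn0 ?xn0.
  - by move=> m p mN; rewrite (state_unit (adm m mN)).
  - move=> m p mN.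
    have [] := local tau _ _ _ _ _ (adm m (ltnW mN)) (step m.+1 mN).
      by rewrite tau_ge0.
    by move=> _; exact.
have Qtau_ge0 : 0 <= Q * tau by rewrite mulr_ge0// ltW.
rewrite big_nat; apply: bigmax_le => // n /andP[_ nN].
rewrite ge_max (err n nN None)/=; apply: bigmax_le => // i _.
exact: (err n nN (Some i)).
Qed.
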